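(* Let $v$ satisfy (V), $\overline{\rho}$ satisfy (I), and $\phi$ satisfy (P). Assume that one of (P1), (P2), (P3), (P4) holds and, in case (P4), assume moreover that (V$^*$) holds. Let $\rho^n$ be the piecewise constant density built from the follow-the-leader particle system associated with the case considered. Then there exist four positive constants $\alpha,\beta,\gamma,\zeta$, independent of $n$, such that $$\mathrm{TV}[\rho^n(\cdot,t)]\le\bigl(\mathrm{TV}[\overline{\rho}]+\alpha t+\beta e^{L't}\bigr)\,e^{\gamma t(1+t)+\zeta e^{L't}}\qquad\text{for all } t\ge 0.$$
   Context: Assumptions. (V) $v:[0,+\infty)\to[0,+\infty)$ is Lipschitz, non-negative, non-increasing, with $v_{\max}:=v(0)<+\infty$. (I) $\overline{\rho}\in L^\infty(\mathbb{R})\cap BV(\mathbb{R})$ is non-negative and compactly supported; throughout $\|\overline{\rho}\|_{L^1(\mathbb{R})}=1$. (P) $\phi\in W^{2,\infty}(\mathbb{R})$. Put $L':=v_{\max}\|\phi'\|_{L^\infty(\mathbb{R})}$. (P1) $\phi(x)\ge 0$ for all $x\in\mathbb{R}$; (P2) $\phi(x)\le 0$ for all $x$; (P3) $x\phi(x)\ge 0$ for all $x$; (P4) $x\phi(x)\le 0$ for all $x$. (V$^*$) There is $R_{\max}>0$ with $\overline{R}:=\|\overline{\rho}\|_{L^\infty(\mathbb{R})}\le R_{\max}$, $v(\rho)>0$ for $\rho<R_{\max}$ and $v(\rho)=0$ for $\rho\ge R_{\max}$. Particles. Let $[\overline{x}_{\min},\overline{x}_{\max}]$ be the convex hull of the support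 of $\overline{\rho}$. For an integer $n\ge 1$ put $\ell_n:=1/n$, $\overline{x}_0:=\overline{x}_{\min}$, $\overline{x}_n:=\overline{x}_{\max}$ and, recursively, $\overline{x}_i:=\sup\{x\in\mathbb{R}:\int_{\overline{x}_{i-1}}^{x}\overline{\rho}(y)\,dy<\ell_n\}$ for $i=1,\dots,n-1$. Let $x_0(t)<\dots<x_n(t)$ be the (unique, global in time) solution, with $x_i(0)=\overline{x}_i$ for all $i$, of the system associated with the case considered, where $R_i(t):=\ell_n/(x_{i+1}(t)-x_i(t))$, $i=0,\dots,n-1$, and $k_n:=\max\{i\in\{0,\dots,n\}:\overline{x}_i\le 0\}$: - case (P1): $\dot x_i=v(R_i)\phi(x_i)$ for $0\le i\le n-1$, $\dot x_n=v_{\max}\phi(x_n)$; - case (P2): $\dot x_0=v_{\max}\phi(x_0)$, $\dot x_i=v(R_{i-1})\phi(x_i)$ for $1\le i\le n$; - case (P3): $\dot x_0=v_{\max}\phi(x_0)$, $\dot x_i=v(R_{i-1})\phi(x_i)$ for $1\le i\le k_n$, $\dot x_i=v(R_i)\phi(x_i)$ for $k_n+1\le i\le n-1$, $\dot x_n=v_{\max}\phi(x_n)$; - case (P4): $\dot x_i=v(R_i)\phi(x_i)$ for $0\le i\le k_n$, $\dot x_i=v(R_{i-1})\phi(x_i)$ for $k_n+1\le i\le n$. In cases (P3) and (P4) only integers $n$ with $2\le k_n\le n-3$ are considered (which presupposes $\overline{x}_{\min}<0<\overline{x}_{\max}$). Approximate density: $\rho^n(x,t):=\sum_{i=0}^{n-1}R_i(t)\,\mathbf{1}_{[x_i(t),x_{i+1}(t))}(x)$.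 $\mathrm{TV}$ denotes total variation on $\mathbb{R}$. *)

(* Defs.v *)
From HB Require Import structures.
From mathcomp Require Import all_boot all_order all_algebra.
From mathcomp Require Import all_classical all_reals all_analysis.

Set Implicit Arguments.
Unset Strict Implicit.
Unset Printing Implicit Defensive.

Import Order.TTheory GRing.Theory Num.Theory.
Import numFieldNormedType.Exports.

Local Open Scope classical_set_scope.
Local Open Scope ring_scope.

Notation leb := (@lebesgue_measure _).

(* Elements of L^p are handled through (Borel) representatives, so the notions
   below (TV, support, sign, norms) only depend on the a.e. class. *)

Definition linfty_norm (R : realType) (f : R -> R) : R :=
  fine ('N[leb]_+oo%E[EFin \o f])%E.

Definition pointwise_TV (R : realType) (f : R -> R) : \bar R :=
  ereal_sup [set V | exists a b : R, a <= b /\ V = total_variation a b f].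

(* Total variation on the whole line of the a.e. class of f, i.e. the least
   pointwise variation of a representative (essential variation). *)
Definition TV (R : realType) (f : R -> R) : \bar R :=
  ereal_inf [set pointwise_TV g | g in [set g : R -> R | g = f %[ae leb]]].

Definition BV (R : realType) (f : R -> R) : Prop :=
  f \in Lfun leb 1%E /\ (TV f < +oo)%E.

(* x is outside the support iff f vanishes a.e. on a neighbourhood of x. *)
Definition ess_support (R : realType) (f : R -> R) : set R :=
  ~` [set x | exists2 U : set R, nbhs x U & f = cst 0 %[ae leb in U]].

Definition test_function (R : realType) (psi : R -> R) : Prop :=
  [/\ forall x : R, derivable psi x 1,
      continuous (derive1 psi) &
      compact (closure [set x | psi x != 0])].

(* Weak derivatives on the line, tested against C^1 functions with compact
   support. *)
Definition weak_derivative (R : realType) (u g : R -> R) : Prop :=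
  [/\ locally_integrable setT u,
      locally_integrable setT g &
      forall psi : R -> R, test_function psi ->
        \int[leb]_x (u x * derive1 psi x) = - \int[leb]_x (g x * psi x)].

Definition W1oo (R : realType) (u : R -> R) : Prop :=
  u \in Lfun leb +oo%E /\
  exists2 g : R -> R, g \in Lfun leb +oo%E & weak_derivative u g.

Definition W2oo (R : realType) (u : R -> R) : Prop :=
  u \in Lfun leb +oo%E /\ exists2 g : R -> R, W1oo g & weak_derivative u g.

(* v is only meaningful on [0, +oo[; its values on negative reals are junk. *)
Definition hyp_V (R : realType) (v : R -> R) : Prop :=
  [/\ [lipschitz v r | r in `[0, +oo[%classic],
      forall r : R, 0 <= r -> 0 <= v r &
      forall r s : R, 0 <= r -> r <= s -> v s <= v r].

Definition hyp_I (R : realType) (rho : R -> R) : Prop :=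
  [/\ rho \in Lfun leb +oo%E,
      BV rho,
      {ae leb, forall x : R, 0 <= rho x},
      compact (ess_support rho) &
      'N[leb]_1[EFin \o rho]%E = 1%E].

(* W^{2,oo} functions are identified with their continuous representative, and
   dphi is (a representative of) the weak derivative of phi. *)
Definition hyp_P (R : realType) (phi dphi : R -> R) : Prop :=
  [/\ W2oo phi, continuous phi & weak_derivative phi dphi].

Definition hyp_Vstar (R : realType) (v rho : R -> R) : Prop :=
  exists Rmax : R,
    [/\ 0 < Rmax,
        linfty_norm rho <= Rmax,
        forall r : R, 0 <= r -> r < Rmax -> 0 < v r &
        forall r : R, Rmax <= r -> v r = 0].

Inductive flow_case := P1 | P2 | P3 | P4.

Definition hyp_sign (R : realType) (c : flow_case) (phi : R -> R) : Prop :=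
  match c with
  | P1 => forall x : R, 0 <= phi x
  | P2 => forall x : R, phi x <= 0
  | P3 => forall x : R, 0 <= x * phi x
  | P4 => forall x : R, x * phi x <= 0
  end.

Definition oriented_integral (R : realType) (f : R -> R) (a b : R) : R :=
  if a <= b then \int[leb]_(x in `[a, b]) f x
  else - \int[leb]_(x in `[b, a]) f x.

Fixpoint xbar_rec (R : realType) (rho : R -> R) (n i : nat) : R :=
  if i is j.+1 then
    sup [set x | oriented_integral rho (xbar_rec rho n j) x < n%:R^-1]
  else inf (ess_support rho).

Definition xbar (R : realType) (rho : R -> R) (n i : nat) : R :=
  if i == n then sup (ess_support rho) else xbar_rec rho n i.

Definition kn (R : realType) (rho : R -> R) (n : nat) : nat :=
  \max_(i < n.+1 | xbar rho n i <= 0) i.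

(* In cases P3 and P4, the bound 2 <= kn forces the set defining kn to be
   nonempty. *)
Definition admissible (R : realType) (c : flow_case) (rho : R -> R) (n : nat) :
    Prop :=
  match c with
  | P1 | P2 => (1 <= n)%N
  | P3 | P4 => (1 <= n)%N /\ (2 <= kn rho n)%N /\ (kn rho n + 3 <= n)%N
  end.

(* A particle configuration is a map x : nat -> R -> R, x i t being the position
   of particle i at time t; only 0 <= i <= n and t >= 0 are meaningful. *)
Definition local_density (R : realType) (n : nat) (x : nat -> R -> R)
    (i : nat) (t : R) : R :=
  n%:R^-1 / (x i.+1 t - x i t).

Definition particle_speed (R : realType) (c : flow_case) (v : R -> R)
    (n k : nat) (x : nat -> R -> R) (i : nat) (t : R) : R :=
  let forward := v (local_density n x i t) in
  let backward := v (local_density n x i.-1 t) in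
  match c with
  | P1 => if i == n then v 0 else forward
  | P2 => if i == 0%N then v 0 else backward
  | P3 => if (i == 0%N) || (i == n) then v 0
          else if (i <= k)%N then backward else forward
  | P4 => if (i <= k)%N then forward else backward
  end.

(* Classical solutions: continuous on [0, +oo[ and solving the system on
   ]0, +oo[. *)
Definition particle_solution (R : realType) (c : flow_case)
    (v rho phi : R -> R) (n : nat) (x : nat -> R -> R) : Prop :=
  [/\ forall i : nat, (i <= n)%N -> x i 0 = xbar rho n i,
      forall (i : nat) (t : R), (i < n)%N -> 0 <= t -> x i t < x i.+1 t,
      forall i : nat, (i <= n)%N -> {within `[0, +oo[, continuous (x i)} &
      forall (i : nat) (t : R), (i <= n)%N -> 0 < t ->
        is_derive t 1 (x i)
          (particle_speed c v n (kn rho n) x i t * phi (x i t))].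

Definition discrete_density (R : realType) (n : nat) (x : nat -> R -> R)
    (t : R) : R -> R :=
  fun y => \sum_(i < n) local_density n x i t * \1_(`[x i t, x i.+1 t[) y.

(* Main.v *)
From HB Require Import structures.
Require Import Defs.
From mathcomp Require Import all_boot all_order all_algebra.
From mathcomp Require Import all_classical all_reals all_analysis.
From mathcomp Require Import measurable_realfun ess_sup_inf.
From mathcomp Require Import ring lra.

Set Implicit Arguments.
Unset Strict Implicit.
Unset Printing Implicit Defensive.

Import Order.TTheory GRing.Theory Num.Theory.
Import numFieldNormedType.Exports.

Local Open Scope classical_set_scope.
Local Open Scope ring_scope.

(** The total variation of the discrete density is at most the sum of the
    absolute values of the jumps between neighbouring cells, the vacuum outside
    included ([TV_discrete_density]).  The theorem is a Gronwall estimate for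
    this sum.

    The four systems are instances of one.  Write R_i for the density of the
    cell between x_i and x_(i+1), with R_(-1) = R_n = 0 for the vacuum, and
    phi^+, phi^- for the positive and negative parts of phi.  In every case
      x_i' = v(R_i) phi^+(x_i) - v(R_(i-1)) phi^-(x_i),
    that is, each particle looks at the cell in front of it
    ([particle_upwind]).  When phi changes sign at the origin, this uses that no
    particle crosses the origin ([two_sided_separation]).

    With l = 1/n, D_i the divided difference of phi between x_i and x_(i+1), and
    R_i = l / (x_(i+1) - x_i), differentiation gives
      R_i' = (R_i^2 / l) [phi^+(x_(i+1)) (v(R_i) - v(R_(i+1)))
                          + phi^-(x_i) (v(R_i) - v(R_(i-1)))]
             - R_i v(R_i) D_i
    ([is_derive_cell_density]).
    - The first term only regularizes.  As v is nonincreasing, it is nonpositive at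
      the densest cell and it never increases the sum of the jumps
      ([transport_le0], [transport_sum_le0]).
    - The second term is at most L' R_i in absolute value, so that
      max R_i = O(exp(L' t)) ([cell_density_upper_bound]).  Its increment between
      neighbouring cells is at most
      C (1 + max R_i) |R_(i+1) - R_i| + O(1/n): phi has bounded derivative, its
      divided differences vary by at most a constant times the width of the
      cells, and min(R_i, R_(i+1)) (x_(i+2) - x_i) <= 2/n
      ([stretching_increment]).
    Summing over the n + 1 particles, the derivative of the sum of the jumps is
    at most C (1 + exp(L' t)) times the sum itself, plus a constant, whence the
    double exponential ([total_jump_bound]).

    The sum of absolute values and the maximum are not differentiable; both are
    maxima of finitely many differentiable functions, and they are compared with
    smooth barriers at the first time of contact ([first_touch]).

    At time 0 each R_i is the mean of rho over a cell, which bounds the sum of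
    the jumps by the variation of any representative of rho
    ([initial_jumps]).  The two bounds on phi are drawn from its weak derivatives
    by testing them against splines that approximate differences of Dirac masses
    ([hyp_P_lipschitz], [hyp_P_divided_difference]). *)

(** * Comparison with barriers *)

Lemma is_derive_cvg (R : realType) (f : R -> R) (x d : R) :
  is_derive x 1 f d -> h^-1 *: (f (h + x) - f x) @[h --> 0^'] --> d.
Proof.
move=> [Df <-]; have := Df; rewrite /derivable /derive.
by under eq_fun do rewrite -[_%:A]/(_ * 1) mulr1.
Qed.

(** At the first time when one member of the family reaches 0 it comes from
    below, so its derivative there is nonnegative.  With a family instead of
    one function, maxima of finitely many differentiable functions are covered
    as well: a bound on [\max_i f i] by a barrier [b] is the case
    [u i = f i - b], where the derivative is needed only for an index that
    realizes the maximum.  The lemma is used in this way for the largest cell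
    density and, with signs as indices, for a sum of absolute values. *)
Lemma first_touch (R : realType) (I : finType) (u : I -> R -> R) :
  (forall i, {within `[0, +oo[, continuous (u i)}) ->
  (forall i, u i 0 < 0) ->
  (forall (t : R) i, 0 < t -> (forall j, u j t <= 0) -> u i t = 0 ->
    exists2 d : R, is_derive t 1 (u i) d & d < 0) ->
  forall i (t : R), 0 <= t -> u i t < 0.
Proof.
move=> cu u0 du i0 t1 t1_ge0; rewrite ltNge; apply/negP => ut1.
pose S := [set t : R | 0 <= t /\ exists i, 0 <= u i t].
have S0 : S !=set0 by exists t1; split => //; exists i0.
have lbS : lbound S 0 by move=> t [].
have hS : has_inf S by split => //; exists 0.
pose t0 : R := inf S.
have t0_ge0 : 0 <= t0 by apply: lb_le_inf.
have before (s : R) i : 0 <= s -> s < t0 -> u i s < 0.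
  move=> s0 st0; rewrite ltNge; apply/negP => us.
  have : t0 <= s by apply: ge_inf; [exists 0|split => //; exists i].
  by rewrite leNgt st0.
have cont i (e : R) : 0 < e -> exists2 d : R, 0 < d &
    forall s, 0 <= s -> `|t0 - s| < d -> `|u i t0 - u i s| < e.
  move=> e0.
  have /subspace_continuousP/(_ t0) := cu i.
  rewrite /= in_itv/= t0_ge0 => /(_ erefl)/cvgrPdist_lt/(_ _ e0).
  rewrite /within/= => /nbhs_ballP[d /= d0 dP].
  exists d => // s s0 ts; apply: (dP s) => //.
  by rewrite /= in_itv/= s0.
(* the set [S] is closed: if every [u i t0] were negative, all of them would
   stay negative for a while after [t0] *)
have [i ui0] : exists i, 0 <= u i t0.
  apply: contrapT => /forallNP noi.
  have neg i : u i t0 < 0 by rewrite ltNge; apply/negP/noi.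
  have /choice[d dP] : forall i, exists d : R, 0 < d /\
      forall s, 0 <= s -> `|t0 - s| < d -> u i s < 0.
    move=> i; have [|d d0 dP] := cont i (- u i t0); first by rewrite oppr_gt0.
    exists d; split => // s s0 /(dP _ s0); rewrite ltr_norml => /andP[+ _].
    lra.
  pose dm := \big[Num.min/1]_i d i.
  have dm0 : 0 < dm by apply/lt_bigmin => // i _; case: (dP i).
  have [s [s0 [i si]] st] : exists2 s, S s & s < t0 + dm.
    by have [s Ss] := inf_adherent dm0 hS; exists s.
  have t0s : t0 <= s by apply: ge_inf; [exists 0|split => //; exists i].
  suff /((dP i).2 s s0) : `|t0 - s| < d i by rewrite ltNge si.
  rewrite distrC ger0_norm ?subr_ge0//.
  by rewrite ltrBlDl (lt_le_trans st)// lerD2l; apply: bigmin_le.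
have t0_gt0 : 0 < t0.
  rewrite lt_neqAle t0_ge0 andbT; apply/eqP => t00.
  by move: ui0; rewrite -t00 leNgt u0.
have le0 j : u j t0 <= 0.
  rewrite leNgt; apply/negP => uj.
  have [d d0 dP] := cont j _ uj.
  pose s := Num.max 0 (t0 - d / 2).
  have s0 : 0 <= s by rewrite le_max lexx.
  have st : s < t0 by rewrite gt_max t0_gt0/=; lra.
  have : `|t0 - s| < d.
    rewrite ger0_norm ?subr_ge0 1?ltW//.
    have : t0 - d / 2 <= s by rewrite le_max lexx orbT.
    lra.
  move=> /(dP _ s0); have := before s j s0 st.
  rewrite ltr_norml => ? /andP[]; lra.
have ui : u i t0 = 0 by apply/eqP; rewrite eq_le le0 ui0.
have [d hd d0] := du _ _ t0_gt0 le0 ui.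
have dcvg := is_derive_cvg hd.
(* the left difference quotients at [t0] are nonnegative *)
have : 0 <= d.
  have dl : h^-1 *: (u i (h + t0) - u i t0) @[h --> 0^'-] --> d.
    apply: cvg_trans dcvg; apply: cvg_app => A [e egt0 Ae].
    by exists e => // x xe xgt0; apply: Ae => //; exact/ltr0_neq0.
  apply: cvgr_to_ge dl _; near=> h; apply: mulr_le0.
    by rewrite invr_le0; apply: ltW; near: h; exists 1 => /=.
  rewrite subr_le0 ui ltW// before//.
    rewrite -lerBlDr sub0r; apply: ltW; near: h.
    exists t0 => // h /=; rewrite sub0r normrN => + h0.
    by rewrite ltr_norml => /andP[].
  rewrite gtrDr; near: h; by exists 1 => /=.
by rewrite leNgt d0.
Unshelve. all: by end_near. Qed.

(** * Total variation of the discrete density *)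

Lemma sum_by_parts (R : pzRingType) (n : nat) (s a : nat -> R) :
  a 0%N = 0 -> a n.+1 = 0 ->
  \sum_(i < n.+1) s i * (a i.+1 - a i) = \sum_(i < n) (s i - s i.+1) * a i.+1.
Proof.
move=> a0 an; under eq_bigr do rewrite mulrBr.
rewrite big_split/= big_ord_recr/= an mulr0 addr0.
rewrite sumrN [X in _ - X]big_ord_recl/= a0 mulr0 add0r -sumrB.
by apply: eq_bigr => i _; rewrite /bump/= add1n -mulrBl.
Qed.

Lemma TV_le_pointwise_TV (R : realType) (f : R -> R) :
  (TV f <= pointwise_TV f)%E.
Proof.
apply: ereal_inf_lbound; exists f => //=.
exact: ae_eq_refl.
Qed.

Lemma total_variation_heaviside (R : realType) (c s a b : R) : a <= b ->
  (total_variation a b (fun y => (c * \1_(`[s, +oo[) y)%R) <= `|c|%:E)%E.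
Proof.
have step d : 0 <= d -> a <= b ->
    (total_variation a b (fun y => (d * \1_(`[s, +oo[) y)%R) <= d%:E)%E.
  move=> d0 ab; have H : {homo (fun y : R => (\1_(`[s, +oo[) y : R)) : x y / x <= y}.
    move=> x y xy; rewrite !indicE !mem_setE !in_itv/= !andbT ler_nat.
    by case: (leP s x) => //= sx; rewrite (le_trans sx xy).
  rewrite nondecreasing_total_variation//; last first.
    by move=> x y _ _ xy; rewrite ler_wpM2l// H.
  by rewrite lee_fin -mulrBr ler_piMr.
move=> ab; have [c0|c0] := leP 0 c; first by rewrite ger0_norm// step.
rewrite ltr0_norm// -total_variationN.
have -> : (\- (fun y => c * \1_(`[s, +oo[) y))%R = (fun y => (- c) * \1_(`[s, +oo[) y).
  by apply/funext => y /=; rewrite mulNr.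
by rewrite step// oppr_ge0 ltW.
Qed.

Lemma total_variation_sum (R : realType) (n : nat) (f : nat -> R -> R)
    (a b : R) : a <= b ->
  (total_variation a b (fun y => (\sum_(i < n) f i y)%R) <=
   \sum_(i < n) total_variation a b (f i))%E.
Proof.
move=> ab; elim: n => [|n IH].
  rewrite big_ord0 nondecreasing_total_variation//.
    by rewrite !big_ord0 subrr.
  by move=> x y _ _ _; rewrite !big_ord0.
rewrite big_ord_recr/=.
under [X in total_variation _ _ X]eq_fun do rewrite big_ord_recr/=.
apply: le_trans (total_variation_le _ _ ab) _.
exact: leeD.
Qed.

(** The cells are numbered from 1 to [n] and padded with the vacuum cells 0 and
    [n.+1], so that particle [i] lies between the cells [i] and [i.+1], and the
    jump of the density at every particle, the two outermost ones included, is
    [cell_density i.+1 - cell_density i]. *)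
Definition cell_density (R : realType) (n : nat) (x : nat -> R -> R) (i : nat)
    (t : R) : R :=
  if (0 < i <= n)%N then local_density n x i.-1 t else 0.

Lemma indic_co_heaviside (R : realType) (a b y : R) : a <= b ->
  \1_(`[a, b[) y = \1_(`[a, +oo[) y - \1_(`[b, +oo[) y :> R.
Proof.
move=> ab; rewrite !indicE !mem_setE !in_itv/= !andbT.
case: (leP a y) => ay /=; case: (ltP y b) => yb /=; rewrite ?subr0 ?subrr//.
by have := le_lt_trans ab (le_lt_trans yb ay); rewrite ltxx.
Qed.

(** A combination of Heaviside functions has variation at most the sum of the
    absolute values of its coefficients, and the coefficients are the jumps. *)
Lemma discrete_density_heaviside (R : realType) (n : nat) (x : nat -> R -> R)
    (t y : R) :
  (forall i, (i < n)%N -> x i t <= x i.+1 t) ->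
  discrete_density n x t y =
  \sum_(i < n.+1) (cell_density n x i.+1 t - cell_density n x i t) *
     \1_(`[x i t, +oo[) y.
Proof.
move=> xle; under eq_bigr do rewrite mulrC.
rewrite (@sum_by_parts _ n (fun i => \1_(`[x i t, +oo[) y)
  (fun i => cell_density n x i t))//; last by rewrite /cell_density ltnn andbF.
apply: eq_bigr => i _; rewrite /cell_density/= ltn_ord.
by rewrite indic_co_heaviside ?xle// mulrC.
Qed.

Lemma TV_discrete_density (R : realType) (n : nat) (x : nat -> R -> R) (t : R) :
  (forall i, (i < n)%N -> x i t <= x i.+1 t) ->
  (TV (discrete_density n x t) <=
   (\sum_(i < n.+1) `|cell_density n x i.+1 t - cell_density n x i t|)%:E)%E.
Proof.
move=> xle; apply: le_trans (TV_le_pointwise_TV _) _.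
apply: ge_ereal_sup => V [a [b [ab ->]]].
pose jump i y := (cell_density n x i.+1 t - cell_density n x i t) *
  \1_(`[x i t, +oo[) y.
rewrite (_ : discrete_density n x t = fun y => \sum_(i < n.+1) jump i y).
  rewrite -sumEFin; apply: le_trans (total_variation_sum n.+1 jump ab) _.
  by apply: lee_sum => i _; exact: total_variation_heaviside.
by apply/funext => y; exact: discrete_density_heaviside.
Qed.

(** * Smooth splines *)

(** Truncated powers are the simplest functions of a prescribed finite
    regularity; test functions are built from them. *)
Definition pospow (R : realType) (k : nat) (x : R) : R := Num.max x 0 ^+ k.

Lemma continuous_pospow (R : realType) (k : nat) : continuous (@pospow R k).
Proof.
move=> x.
apply: (@continuous_comp _ _ _ (fun y : R => Num.max y 0) (fun y => y ^+ k)).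
  by apply: continuous_max; [exact: cvg_id|exact: cst_continuous].
exact: exprn_continuous.
Qed.

Lemma is_derive_pospow (R : realType) (k : nat) (x : R) :
  is_derive x 1 (@pospow R k.+2) (k.+2%:R * pospow k.+1 x).
Proof.
have [x0|x0|->] := ltrgtP x 0.
- rewrite {2}/pospow (max_idPr (ltW x0)) expr0n mulr0.
  apply: (@near_eq_is_derive _ _ _ (cst 0)).
    near=> y; rewrite /pospow max_r ?expr0n// ltW//.
    by near: y; exact: lt_nbhsl.
- rewrite {2}/pospow (max_idPl (ltW x0)).
  refine (@near_eq_is_derive _ R^o R^o (fun y => y ^+ k.+2) _ _ _ _ _ _).
    near=> y; rewrite /pospow max_l// ltW//.
    by near: y; exact: lt_nbhsr.
  by split; [exact: exprn_derivable|rewrite exp_derive scaler1].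
rewrite {2}/pospow maxxx expr0n mulr0.
apply/is_derive1_caratheodory; exists (@pospow R k.+1); split.
- move=> z; rewrite /pospow maxxx expr0n/= !subr0.
  by case: (leP z 0) => z0; rewrite ?expr0n ?mul0r//= exprSr.
- exact: continuous_pospow.
- by rewrite /pospow maxxx expr0n.
Unshelve. all: by end_near. Qed.

Lemma is_derive_shift (R : realType) (f : R -> R) (c x d : R) :
  is_derive (x - c) 1 f d -> is_derive x 1 (fun y : R => f (y - c)) d.
Proof.
move=> Df; have Dg : is_derive x 1 (fun y : R => y - c) 1.
  by apply: is_derive_eq; exact: (@subr0 R 1).
have := @is_derive1_comp _ f (fun y : R => y - c) x _ _ Df Dg.
by rewrite mulr1.
Qed.

(** For [k = 1] this is the tent of mass 1 supported in [0, 2 e], an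
    approximation of the Dirac mass; [k = 2] and [k = 3] are its successive
    primitives, that is mollifications of the Heaviside function and of the
    positive part. *)
Definition bspline (R : realType) (k : nat) (e x : R) : R :=
  (pospow k x - pospow k (x - e) *+ 2 + pospow k (x - e *+ 2)) /
  (k`!%:R * e ^+ 2).

Lemma is_derive_bspline (R : realType) (k : nat) (e x : R) :
  is_derive x 1 (bspline k.+2 e) (bspline k.+1 e x).
Proof.
have D (c : R) : is_derive x 1 (fun y : R => pospow k.+2 (y - c))
                     (k.+2%:R * pospow k.+1 (x - c)).
  exact/is_derive_shift/is_derive_pospow.
have D0 := is_derive_pospow k x; have D1 := D e; have D2 := D (e *+ 2).
have -> : bspline k.+2 e = (k.+2`!%:R * e ^+ 2)^-1 \*:
    ((pospow k.+2 : R -> R) - ((fun y : R => pospow k.+2 (y - e)) *+ 2) +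
     (fun y : R => pospow k.+2 (y - e *+ 2))).
  by apply/funext => y; rewrite /bspline mulrC.
apply: is_derive_eq; rewrite /bspline factS natrM -mulrA invfM.
set w := (_ * _)^-1; rewrite /GRing.scale/=.
have k0 : k.+2%:R != 0 :> R by rewrite pnatr_eq0.
by move: w (k.+2%:R) k0 => w K K0; field.
Qed.

Lemma continuous_bspline (R : realType) (k : nat) (e : R) :
  continuous (bspline k e).
Proof.
move=> x.
have C (c : R) : {for x, continuous (fun y : R => pospow k (y - c))}.
  apply: (@continuous_comp _ _ _ (fun y : R => y - c) (@pospow R k)).
    by apply: continuousB; [exact: cvg_id|exact: cst_continuous].
  exact: continuous_pospow.
apply: cvgM; last exact: cvg_cst.
apply: cvgD; last exact: C.
apply: cvgB; first exact: continuous_pospow.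
by rewrite mulr2n; under eq_fun do rewrite mulr2n; apply: cvgD; exact: C.
Qed.

Lemma pospow_le0 (R : realType) k (x : R) : x <= 0 -> pospow k.+1 x = 0.
Proof. by move=> x0; rewrite /pospow max_r// expr0n. Qed.

Lemma pospow_ge0 (R : realType) k (x : R) : 0 <= x -> pospow k x = x ^+ k.
Proof. by move=> x0; rewrite /pospow max_l. Qed.

Lemma bspline_le0 (R : realType) k (e x : R) : 0 < e -> x <= 0 ->
  bspline k.+1 e x = 0.
Proof.
move=> e0 x0; rewrite /bspline !pospow_le0.
  by rewrite mul0rn subr0 addr0 mul0r.
all: by rewrite ?mulr2n; lra.
Qed.

Lemma bspline1_ge0 (R : realType) (e x : R) : 0 < e -> 0 <= bspline 1 e x.
Proof.
move=> e0; rewrite /bspline; apply: divr_ge0; last by rewrite mulr_ge0 ?sqr_ge0.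
rewrite /pospow !expr1 !mulr2n.
by case: (leP x 0); case: (leP (x - e) 0); case: (leP (x - (e + e)) 0); lra.
Qed.

Lemma bspline1_ge (R : realType) (e x : R) : 0 < e -> e *+ 2 <= x ->
  bspline 1 e x = 0.
Proof.
move=> e0; rewrite mulr2n => ex.
by rewrite /bspline !pospow_ge0 ?mulr2n; lra.
Qed.

Lemma bspline2_ge (R : realType) (e x : R) : 0 < e -> e *+ 2 <= x ->
  bspline 2 e x = 1.
Proof.
move=> e0; rewrite mulr2n => ex; rewrite /bspline !pospow_ge0;
  try (rewrite ?mulr2n; lra).
by rewrite (_ : 2`! = 2)%N //; field; lra.
Qed.

Lemma bspline3_ge (R : realType) (e x : R) : 0 < e -> e *+ 2 <= x ->
  bspline 3 e x = x - e.
Proof.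
move=> e0; rewrite mulr2n => ex; rewrite /bspline !pospow_ge0;
  try (rewrite ?mulr2n; lra).
by rewrite (_ : 3`! = 6)%N //; field; lra.
Qed.

Lemma is_derive_continuous (R : realType) (f df : R -> R) :
  (forall t : R, is_derive t 1 f (df t)) -> continuous f.
Proof. by move=> D t; exact/differentiable_continuous/derivable1_diffP. Qed.

Lemma derive_ge0_homo (R : realType) (f df : R -> R) :
  (forall x : R, is_derive x 1 f (df x)) -> (forall x, 0 <= df x) ->
  {homo f : x y / x <= y}.
Proof.
move=> fD df0 x y xy.
have [|c _] := @MVT_segment _ f df x y xy (fun z _ => fD z).
  by apply: continuous_subspaceT; exact: is_derive_continuous fD.
by move=> /eqP; rewrite subr_eq => /eqP ->; rewrite lerDr mulr_ge0// subr_ge0.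
Qed.

Lemma bspline2_itv (R : realType) (e x : R) : 0 < e -> 0 <= bspline 2 e x <= 1.
Proof.
move=> e0; have ndecr : {homo bspline 2 e : y z / y <= z}.
  apply: derive_ge0_homo => y; first exact: is_derive_bspline.
  exact: bspline1_ge0.
apply/andP; split.
  rewrite -(@bspline_le0 _ 1 _ (Num.min x 0) e0) ?ge_min ?lexx ?orbT//.
  by rewrite ndecr// ge_min lexx.
rewrite -(@bspline2_ge _ _ (Num.max x (e *+ 2)) e0) ?le_max ?lexx ?orbT//.
by rewrite ndecr// le_max lexx.
Qed.

Lemma bspline3_lip (R : realType) (e x y : R) : 0 < e -> x <= y ->
  0 <= bspline 3 e y - bspline 3 e x <= y - x.
Proof.
move=> e0 xy; have ndecr : {homo bspline 3 e : y z / y <= z}.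
  apply: derive_ge0_homo => z; first exact: is_derive_bspline.
  by case/andP: (bspline2_itv z e0).
have ndecrN : {homo (id - bspline 3 e : R -> R) : y z / y <= z}.
  apply: (@derive_ge0_homo _ _ (fun z => 1 - bspline 2 e z)) => z.
    by have := is_derive_bspline 1 e z => ?; exact: is_deriveB.
  by case/andP: (bspline2_itv z e0); rewrite subr_ge0.
rewrite subr_ge0 ndecr//=.
by have := ndecrN _ _ xy; rewrite /= -![(id - _) _]/(_ - _); lra.
Qed.

(** * Pointwise consequences of weak differentiability *)

Lemma Rintegral_support (R : realType) (f : R -> R) (A B : R) :
  (forall x, ~~ (A <= x <= B) -> f x = 0) ->
  \int[leb]_x f x = \int[leb]_(x in `[A, B]) f x.
Proof.
move=> f0; rewrite [RHS]Rintegral_mkcond; apply: eq_Rintegral => x _.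
rewrite patchE; case: ifPn => //; rewrite notin_setE/= in_itv/= => /negP.
exact: f0.
Qed.

Lemma integrable_continuous_itv (R : realType) (f : R -> R) (A B : R) :
  continuous f -> leb.-integrable `[A, B] (EFin \o f).
Proof.
move=> cf; apply: continuous_compact_integrable; first exact: segment_compact.
exact: continuous_subspaceT.
Qed.

(** Support conditions are stated with an explicit interval, which turns the
    integrals over the line into integrals over a segment. *)
Lemma test_functionI (R : realType) (psi dpsi : R -> R) (A B : R) :
  (forall x : R, is_derive x 1 psi (dpsi x)) -> continuous dpsi ->
  (forall x, ~~ (A <= x <= B) -> psi x = 0) ->
  test_function psi /\ derive1 psi = dpsi.
Proof.
move=> D cd s0.
have dE : derive1 psi = dpsi by apply/funext => x; rewrite derive1E derive_val.
split => //; split; [by move=> x; case: (D x)|by rewrite dE|].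
apply: (@subclosed_compact _ _ `[A, B]%classic).
- exact: closed_closure.
- exact: segment_compact.
- have /closure_id -> : closed `[A, B]%classic by exact: interval_closed.
  apply: closureS => x /=; rewrite in_itv/=; apply: contraNT => /s0 ->.
  by rewrite eqxx.
Qed.

Lemma weak_derivative_itv (R : realType) (u g psi dpsi : R -> R) (A B : R) :
  weak_derivative u g ->
  (forall x : R, is_derive x 1 psi (dpsi x)) -> continuous dpsi ->
  (forall x, ~~ (A <= x <= B) -> psi x = 0) ->
  (forall x, ~~ (A <= x <= B) -> dpsi x = 0) ->
  \int[leb]_(x in `[A, B]) (u x * dpsi x) =
  - \int[leb]_(x in `[A, B]) (g x * psi x).
Proof.
move=> [_ _ wd] D cd s0 d0.
have [tf dE] := test_functionI D cd s0.
have := wd _ tf; rewrite dE (@Rintegral_support _ _ A B); last first.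
  by move=> x /d0 ->; rewrite mulr0.
by move=> ->; rewrite (@Rintegral_support _ _ A B)// => x /s0 ->; rewrite mulr0.
Qed.

Lemma continuous_bspline_shift (R : realType) (k : nat) (e a : R) :
  continuous (fun x : R => bspline k e (x - a)).
Proof.
move=> x; apply: (@continuous_comp _ _ _ (fun y : R => y - a) (bspline k e)).
  by apply: continuousB; [exact: cvg_id|exact: cst_continuous].
exact: continuous_bspline.
Qed.

Lemma is_derive_bspline_shift (R : realType) (k : nat) (e a x : R) :
  is_derive x 1 (fun y : R => bspline k.+2 e (y - a)) (bspline k.+1 e (x - a)).
Proof.
exact/is_derive_shift/is_derive_bspline.
Qed.

Lemma Rintegral_bspline1 (R : realType) (e a A B : R) :
  0 < e -> A < B -> A <= a -> a + e *+ 2 <= B ->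
  \int[leb]_(x in `[A, B]) bspline 1 e (x - a) = 1.
Proof.
move=> e0 AB Aa aB.
rewrite /Rintegral (@continuous_FTC2 _ _ (fun x => bspline 2 e (x - a)))//.
- rewrite -EFinB /= bspline2_ge ?bspline_le0 ?subr0 ?subr_le0//.
  by rewrite lerBrDl.
- by apply: continuous_subspaceT; exact: continuous_bspline_shift.
- split => [x _||].
  + by case: (is_derive_bspline_shift 0 e a x).
  + by apply: cvg_at_right_filter; exact: continuous_bspline_shift.
  + by apply: cvg_at_left_filter; exact: continuous_bspline_shift.
- move=> x _; rewrite derive1E; have := is_derive_bspline_shift 0 e a x => D.
  by rewrite derive_val.
Qed.

Lemma bspline1_delta (R : realType) (phi : R -> R) (a A B : R) :
  continuous phi -> A <= a -> a + 2 <= B ->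
  (\int[leb]_(x in `[A, B]) (phi x * bspline 1 m.+1%:R^-1 (x - a)))
    @[m --> \oo] --> phi a.
Proof.
move=> cphi Aa aB.
have AB : A < B by rewrite (le_lt_trans Aa)// (lt_le_trans _ aB)// ltrDl.
apply/cvgrPdist_le => eta eta0.
have := cphi a => /cvgrPdist_le/(_ _ eta0) [d /= d0 dP].
have d20 : 0 < d / 2 by rewrite divr_gt0.
near=> m.
set e : R := m.+1%:R^-1; have e0 : 0 < e by rewrite invr_gt0.
have ed : e *+ 2 < d.
  rewrite -mulr_natr -ltr_pdivlMr// /e; near: m.
  exact: (near_infty_natSinv_lt (PosNum d20)).
have e1 : e <= 1 by rewrite invf_le1// ler1n.
have aeB : a + e *+ 2 <= B by rewrite mulr2n; lra.
have ci (f : R -> R) : continuous f ->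
    continuous (fun x => f x * bspline 1 e (x - a)).
  by move=> cf x; apply: cvgM; [exact: cf|exact: continuous_bspline_shift].
rewrite -[X in `|X - _|]mulr1 -(Rintegral_bspline1 e0 AB Aa aeB).
rewrite -RintegralZl//; last exact/integrable_continuous_itv/continuous_bspline_shift.
rewrite -RintegralB//; last 2 first.
- exact/integrable_continuous_itv/(ci (cst (phi a)))/cst_continuous.
- exact/integrable_continuous_itv/ci.
have cd : continuous (fun x => phi a * bspline 1 e (x - a) -
                              phi x * bspline 1 e (x - a)).
  move=> x; apply: cvgB; last exact: ci.
  exact: (ci (cst (phi a)) (@cst_continuous _ _ _)).
apply: le_trans (le_normr_Rintegral _ _) _ => //.
  exact: integrable_continuous_itv.
rewrite -[leRHS]mulr1 -(Rintegral_bspline1 e0 AB Aa aeB).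
rewrite -RintegralZl//; last exact/integrable_continuous_itv/continuous_bspline_shift.
apply: le_Rintegral => //.
- by apply/integrable_continuous_itv => x; apply: cvg_norm; exact: cd.
- exact/integrable_continuous_itv/(ci (cst eta))/cst_continuous.
move=> x _; rewrite -mulrBl normrM (ger0_norm (bspline1_ge0 _ e0)).
have [xa|xa] := leP x a; first by rewrite bspline_le0 ?subr_le0// !mulr0.
have [ex|ex] := leP (e *+ 2) (x - a); first by rewrite bspline1_ge// !mulr0.
rewrite ler_wpM2r ?bspline1_ge0//; apply: dP => /=.
by rewrite distrC gtr0_norm ?subr_gt0// (lt_trans ex).
Unshelve. all: by end_near. Qed.

Lemma locally_integrable_itv (R : realType) (g : R -> R) (A B : R) :
  locally_integrable setT g -> leb.-integrable `[A, B] (EFin \o g).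
Proof.
move=> [mg _ ig]; apply/integrableP; split.
  by apply/measurable_EFinP; exact: measurable_funS mg.
by apply: ig => //; exact: segment_compact.
Qed.

Lemma dominated_Rintegral_cvg (R : realType) (D : set R) (f : nat -> R -> R)
    (l g : R -> R) :
  measurable D ->
  (forall m, measurable_fun D (f m)) -> measurable_fun D l ->
  (forall x, D x -> f m x @[m --> \oo] --> l x) ->
  leb.-integrable D (EFin \o g) ->
  (forall m x, D x -> `|f m x| <= g x) ->
  \int[leb]_(x in D) f m x @[m --> \oo] --> \int[leb]_(x in D) l x.
Proof.
move=> mD mf ml fl ig fg.
have mF (h : R -> R) : measurable_fun D h -> measurable_fun D (EFin \o h).
  by move=> ?; exact/measurable_EFinP.
have flE : {ae leb, forall x, D x -> (f m x)%:E @[m --> \oo] --> (l x)%:E}.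
  by apply: aeW => x Dx; apply/cvg_EFin; [exact: nearW|exact: fl].
have fgE : {ae leb, forall x m, D x -> (`|(f m x)%:E| <= (EFin \o g) x)%E}.
  by apply: aeW => x m Dx; rewrite /= lee_fin fg.
have [il _ cvgl] := @dominated_convergence _ _ _ leb D mD (fun m => EFin \o f m)
  (EFin \o l) (EFin \o g) (fun m => mF _ (mf m)) (mF _ ml) flE ig fgE.
by apply: fine_cvg; rewrite fineK//; exact: integrable_fin_num.
Qed.

Lemma bspline2_cvg (R : realType) (y : R) :
  bspline 2 m.+1%:R^-1 y @[m --> \oo] --> ((0 < y)%R%:R : R).
Proof.
have [y0|y0] := ltP 0 y; last first.
  by under eq_fun do rewrite bspline_le0//; exact: cvg_cst.
apply: cvg_near_cst; have y20 : 0 < y / 2 by rewrite divr_gt0.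
near=> m; apply: bspline2_ge; rewrite ?invr_gt0//.
rewrite -[leLHS]mulr_natr -ler_pdivlMr// ltW//; near: m.
exact: (near_infty_natSinv_lt (PosNum y20)).
Unshelve. all: by end_near. Qed.

(** Test against the mollified indicator of [a, b]: the mollification tends to
    the indicator itself, and its derivative to a difference of two Dirac
    masses. *)
Lemma weak_derivative_increment (R : realType) (u g : R -> R) (a b : R) :
  continuous u -> weak_derivative u g -> a <= b ->
  \int[leb]_(x in `[a, b]) g x = u b - u a.
Proof.
move=> cu wd ab.
pose e (m : nat) : R := m.+1%:R^-1.
have e0 m : 0 < e m by rewrite invr_gt0.
have e1 m : e m <= 1 by rewrite invf_le1// ler1n.
pose psi m (x : R) := bspline 2 (e m) (x - a) - bspline 2 (e m) (x - b).
pose dpsi m (x : R) := bspline 1 (e m) (x - a) - bspline 1 (e m) (x - b).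
pose B := b + 2.
have supp m x : ~~ (a <= x <= B) -> psi m x = 0 /\ dpsi m x = 0.
  rewrite negb_and -!ltNge => /orP[xa|Bx].
    by rewrite /psi /dpsi !bspline_le0 ?subrr// lerBlDr add0r; lra.
  have ? := e1 m; have ? := e0 m; rewrite /B in Bx.
  by rewrite /psi /dpsi !bspline2_ge ?bspline1_ge ?subrr// mulr2n; lra.
have Dpsi m (x : R) : is_derive x 1 (psi m) (dpsi m x).
  have Da := is_derive_bspline_shift 0 (e m) a x.
  have Db := is_derive_bspline_shift 0 (e m) b x.
  exact: is_deriveB.
have cdpsi m : continuous (dpsi m).
  by move=> x; apply: cvgB; exact: continuous_bspline_shift.
have wE m : \int[leb]_(x in `[a, B]) (u x * dpsi m x) =
            - \int[leb]_(x in `[a, B]) (g x * psi m x).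
  by apply: (weak_derivative_itv wd (Dpsi m) (cdpsi m)) => x /(supp m)[].
have lim1 : \int[leb]_(x in `[a, B]) (u x * dpsi m x) @[m --> \oo] --> u a - u b.
  have aB : a + 2 <= B by rewrite lerD2r.
  have H := cvgB (bspline1_delta cu (lexx a) aB) (bspline1_delta cu ab (lexx B)).
  apply: (cvg_trans _ (H _)); apply: near_eq_cvg.
  apply: nearW => m /=.
  have ci c : continuous (fun x => u x * bspline 1 (e m) (x - c)).
    by move=> x; apply: cvgM; [exact: cu|exact: continuous_bspline_shift].
  rewrite /= -[LHS]RintegralB//; try exact/integrable_continuous_itv/ci.
  by apply: eq_Rintegral => x _; rewrite mulrBr.
have [lg mg ig] : [/\ locally_integrable setT g, measurable_fun setT g &
    leb.-integrable `[a, B] (EFin \o g)].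
  case: wd => _ lg _; split => //; last exact: locally_integrable_itv.
  by case: lg.
have lim2 : \int[leb]_(x in `[a, B]) (g x * psi m x) @[m --> \oo] -->
    \int[leb]_(x in `[a, B]) (g x * \1_(`]a, b]) x).
  apply: (@dominated_Rintegral_cvg _ _ _ _ (fun x => `|g x|)) => //.
  - move=> m; apply: measurable_funM; first exact: measurable_funS mg.
    apply: measurable_funTS; apply: continuous_measurable_fun => x.
    by apply: cvgB; exact: continuous_bspline_shift.
  - apply: measurable_funM; first exact: measurable_funS mg.
    exact: measurable_indic.
  - move=> x _; apply: cvgM; first exact: cvg_cst.
    have -> : \1_`]a, b] x = (0 < x - a)%R%:R - (0 < x - b)%R%:R :> R.
      rewrite indicE mem_setE in_itv/= !subr_gt0.
      case: (ltP a x) => ax; case: (ltP b x) => bx; rewrite ?subrr ?subr0//=.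
      by have := le_lt_trans ax (le_lt_trans ab bx); rewrite ltxx.
    by apply: cvgB; exact: bspline2_cvg.
  - exact: integrable_norm.
  - move=> m x _; rewrite normrM ler_piMr// ler_norml /psi.
    case/andP: (bspline2_itv (x - a) (e0 m)) => ? ?.
    case/andP: (bspline2_itv (x - b) (e0 m)) => ? ?.
    by apply/andP; split; lra.
have lim3 : \int[leb]_(x in `[a, B]) (u x * dpsi m x) @[m --> \oo] -->
    - \int[leb]_(x in `[a, B]) (g x * \1_(`]a, b]) x).
  by under eq_fun do rewrite wE; exact: cvgN.
have -> : u b - u a = \int[leb]_(x in `[a, B]) (g x * \1_(`]a, b]) x).
  apply: oppr_inj; rewrite opprB.
  by apply: (cvg_unique _ lim1 lim3); exact: Rhausdorff.
rewrite -Rintegral_itv_obnd_cbnd; last first.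
  apply: (integrableS _ _ _ ig) => //.
  apply: subset_itv; rewrite bnd_simp//.
  by rewrite lerDl.
rewrite [LHS]Rintegral_mkcond [RHS]Rintegral_mkcond; apply: eq_Rintegral => x _.
rewrite !patchE indicE !mem_setE !in_itv/=.
case: ifPn => [/andP[ax xb]|]; last by rewrite mulr0; case: ifPn.
by rewrite (ltW ax) /B (le_trans xb) ?lerDl//= mulr1.
Qed.

Lemma ae_lebW (R : realType) (P Q : R -> Prop) : (forall x, P x -> Q x) ->
  {ae leb, forall x, P x} -> {ae leb, forall x, Q x}.
Proof. by move=> PQ; apply: filterS; first exact: (ae_filter_ringOfSetsType leb). Qed.

Lemma ae_leb2 (R : realType) (P Q : R -> Prop) :
  {ae leb, forall x, P x} -> {ae leb, forall x, Q x} ->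
  {ae leb, forall x, P x /\ Q x}.
Proof.
move=> hP hQ; apply: (@filterS2 _ _ (ae_filter_ringOfSetsType leb) _ _ _ _ hP hQ).
by move=> x.
Qed.

Lemma Linfty_ess_sup (R : realType) (f : R -> R) :
  ('N[leb]_+oo%E[EFin \o f] = ess_sup leb (abse \o (EFin \o f)))%E.
Proof.
rewrite unlock ifT//.
rewrite (@lt_le_trans _ _ (leb (`[0%R, 1%R]%classic : set R) : \bar R)%E)//.
  by rewrite lebesgue_measure_itv/= lte_fin ltr01 oppr0 adde0 lte_fin.
by apply: le_measure => //; rewrite inE; [exact: measurable_itv|exact: measurableT].
Qed.

Lemma ae_le_linfty_norm (R : realType) (f : R -> R) (G : R) :
  {ae leb, forall x, `|f x| <= G} ->
  {ae leb, forall x, `|f x| <= linfty_norm f}.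
Proof.
move=> fG; have Nfin : ('N[leb]_+oo%E[EFin \o f])%E \is a fin_num.
  rewrite ge0_fin_numE ?Lnorm_ge0// Linfty_ess_sup.
  by apply: (@le_lt_trans _ _ G%:E); [exact/ess_supP|exact: ltry].
have := ess_sup_ge leb (abse \o (EFin \o f)).
rewrite -Linfty_ess_sup -(fineK Nfin).
by apply: filterS => x /=; rewrite lee_fin.
Qed.

Lemma Lfun_oo_bounded (R : realType) (f : R -> R) : f \in Lfun leb +oo%E ->
  exists2 G : R, 0 <= G & {ae leb, forall x, `|f x| <= G}.
Proof.
case/andP => _; rewrite inE/= /finite_norm => Nfin.
exists (linfty_norm f); first by rewrite fine_ge0// Lnorm_ge0.
have := ess_sup_ge leb (abse \o (EFin \o f)).
rewrite -Linfty_ess_sup -(@fineK _ ('N[leb]_+oo%E[EFin \o f])%E); last first.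
  by rewrite ge0_fin_numE// Lnorm_ge0.
by apply: filterS => x /=; rewrite lee_fin.
Qed.

Lemma Rintegral_le_bound (R : realType) (g : R -> R) (G a b : R) :
  a <= b -> 0 <= G -> leb.-integrable `[a, b] (EFin \o g) ->
  {ae leb, forall x, `[a, b]%classic x -> `|g x| <= G} ->
  `|\int[leb]_(x in `[a, b]) g x| <= G * (b - a).
Proof.
move=> ab G0 ig gG; apply: le_trans (le_normr_Rintegral _ _) _ => //.
rewrite -lee_fin fineK; last first.
  by apply: integrable_fin_num => //; exact: integrable_norm.
have H := @integral_le_bound _ _ R leb `[a, b]%classic (EFin \o g) G%:E.
apply: le_trans (H _ _ _ _) _ => //.
- by case/integrableP : ig.
- rewrite [X in (_ * X <= _)%E](_ : _ = (b - a)%:E)//.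
  have := lebesgue_measure_itv (Interval (BLeft a) (BRight b)).
  move=> /= ->; rewrite lte_fin; case: ltP => ba; first by [].
  by have -> : b = a; [lra|rewrite subrr].
Qed.

Lemma weak_derivative_lipschitz (R : realType) (u g : R -> R) (G : R) :
  continuous u -> weak_derivative u g -> 0 <= G ->
  {ae leb, forall x, `|g x| <= G} ->
  forall a b : R, `|u b - u a| <= G * `|b - a|.
Proof.
move=> cu wd G0 gG a b.
wlog ab : a b / a <= b.
  move=> H; have [|/ltW] := leP a b; first exact: H.
  by move=> /H; rewrite distrC [`|a - b|]distrC.
rewrite -(weak_derivative_increment cu wd ab) [`|b - a|]ger0_norm ?subr_ge0//.
apply: Rintegral_le_bound => //; last first.
  by apply: ae_lebW gG => x + _.
by apply: locally_integrable_itv; case: wd.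
Qed.

(** On each half-line [-m, +oo[ the function differs by a constant from the
    primitive of [g], to which the Lebesgue differentiation theorem applies. *)
Lemma weak_derivative_ae (R : realType) (u g : R -> R) :
  continuous u -> weak_derivative u g ->
  {ae leb, forall x : R, is_derive x 1 u (g x)}.
Proof.
move=> cu wd; have [_ lg _] := wd.
have ae1 (m : nat) : {ae leb, forall x : R, (- m%:R < x) -> is_derive x 1 u (g x)}.
  have := @FTC1 R g (BLeft (- m%:R)) (fun y => locally_integrable_itv _ _ lg) lg.
  apply: ae_lebW => x /= + mx; rewrite lte_fin mx => /(_ erefl) [dF Fx].
  pose F y := \int[leb]_(t in `[- m%:R, y]) g t.
  have DF : is_derive x 1 (fun y : R => F y + u (- m%:R)) (g x).
    have DF : is_derive x 1 F (g x) by split; [exact: dF|rewrite -derive1E Fx].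
    have DD := is_deriveD DF (is_derive_cst (u (- m%:R)) x (1 : R)).
    by apply: (is_derive_eq DD); exact: (@addr0 R).
  apply: near_eq_is_derive DF; near=> y.
  rewrite /F (weak_derivative_increment cu wd) ?subrK//.
  by apply: ltW; near: y; exact: lt_nbhsr.
have := ae_foralln ae1; apply: ae_lebW => x H.
apply: (H (Num.truncn `|x|).+1).
rewrite ltrNl (le_lt_trans (ler_norm _))// normrN.
by have /andP[] := truncn_itv (normr_ge0 x).
Unshelve. all: by end_near. Qed.

Lemma is_derive_lipschitz_le (R : realType) (u : R -> R) (G x d : R) :
  (forall a b : R, `|u b - u a| <= G * `|b - a|) -> is_derive x 1 u d ->
  `|d| <= G.
Proof.
move=> lip hd.
apply: cvgr_to_le (cvg_norm (is_derive_cvg hd)) _; near=> h.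
have h0 : h != 0 by near: h; exact: nbhs_dnbhs_neq.
rewrite /= -[_ *: _]/(_ * _) normrM normfV mulrC ler_pdivrMr ?normr_gt0//.
by rewrite (le_trans (lip _ _))// addrK.
Unshelve. all: by end_near. Qed.

(** [linfty_norm dphi] is meaningful only if [dphi] is essentially bounded.  By
    hypothesis some weak derivative [g] of [phi] is; it makes [phi] Lipschitz,
    so the a.e. derivative of [phi], which is [dphi], is bounded too. *)
Lemma hyp_P_lipschitz (R : realType) (phi dphi : R -> R) : hyp_P phi dphi ->
  forall a b : R, `|phi b - phi a| <= linfty_norm dphi * `|b - a|.
Proof.
move=> [[_ [g [/Lfun_oo_bounded[G G0 gG] _] wg]] cphi wd].
have lip := weak_derivative_lipschitz cphi wg G0 gG.
have dG : {ae leb, forall x, `|dphi x| <= G}.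
  apply: ae_lebW (weak_derivative_ae cphi wd) => x.
  exact: is_derive_lipschitz_le.
apply: (weak_derivative_lipschitz cphi wd); last exact: ae_le_linfty_norm dG.
by rewrite fine_ge0// Lnorm_ge0.
Qed.

(** The difference of two adjacent divided differences is the pairing of [phi]
    with three Dirac masses, that is with the second derivative of a piecewise
    affine function with slopes of opposite signs on [a, b] and [b, c].  Once
    mollified, this function is a cubic spline bounded by 1 and supported near
    [a, c], so both derivatives can be moved onto [phi], whose second weak
    derivative is bounded. *)
Lemma hyp_P_divided_difference (R : realType) (phi dphi : R -> R) :
  hyp_P phi dphi -> exists2 H : R, 0 <= H & forall a b c : R, a < b -> b < c ->
  `|(phi c - phi b) / (c - b) - (phi b - phi a) / (b - a)| <= H * (c - a).
Proof.
move=> [[_ [g [_ [h /Lfun_oo_bounded[H H0 hH] wh]] wg]] cphi _].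
exists (H *+ 2) => [|a b c ab bc]; first by rewrite mulrn_wge0.
pose e (m : nat) : R := m.+1%:R^-1.
have e0 m : 0 < e m by rewrite invr_gt0.
have e1 m : e m <= 1 by rewrite invf_le1// ler1n.
pose chi k m (x : R) :=
  (bspline k (e m) (x - a) - bspline k (e m) (x - b)) / (b - a) -
  (bspline k (e m) (x - b) - bspline k (e m) (x - c)) / (c - b).
have supp m x : ~~ (a <= x <= c + (e m) *+ 2) ->
    [/\ chi 1 m x = 0, chi 2 m x = 0 & chi 3 m x = 0].
  have ? := e0 m; rewrite negb_and -!ltNge mulr2n => /orP[xa|cx].
    by rewrite /chi !bspline_le0 ?subrr ?mul0r ?subrr//; lra.
  rewrite /chi !bspline1_ge ?bspline2_ge ?bspline3_ge ?mulr2n ?subrr ?mul0r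
    ?subrr//; try lra.
  split => //; field; rewrite !subr_eq0 !gt_eqF//.
have cchi k m : continuous (chi k m).
  move=> x; apply: cvgB; (apply: cvgM; last exact: cvg_cst);
    by apply: cvgB; exact: continuous_bspline_shift.
have Dchi k m (x : R) : is_derive x 1 (chi k.+2 m) (chi k.+1 m x).
  have D y := is_derive_bspline_shift k (e m) y x.
  have DD := is_deriveB (is_deriveZ (b - a)^-1 (is_deriveB (D a) (D b)))
                        (is_deriveZ (c - b)^-1 (is_deriveB (D b) (D c))).
  have -> : chi k.+2 m = (b - a)^-1 \*: ((fun x => bspline k.+2 (e m) (x - a)) -
      (fun x => bspline k.+2 (e m) (x - b))) - (c - b)^-1 \*:
      ((fun x => bspline k.+2 (e m) (x - b)) - (fun x => bspline k.+2 (e m) (x - c))).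
    by apply/funext => y; rewrite /chi ![_ / (_ - _)]mulrC.
  by apply: (is_derive_eq DD); rewrite /chi ![_ / (_ - _)]mulrC.
pose B := c + 2.
have suppB m x : ~~ (a <= x <= B) ->
    [/\ chi 1 m x = 0, chi 2 m x = 0 & chi 3 m x = 0].
  move=> xB; apply: supp; apply: contra xB => /andP[-> /= xc].
  by have ? := e1 m; rewrite /B (le_trans xc)// mulr2n; lra.
have w m : \int[leb]_(x in `[a, B]) (phi x * chi 1 m x) =
           \int[leb]_(x in `[a, c + e m *+ 2]) (h x * chi 3 m x).
  rewrite (weak_derivative_itv wg (Dchi 0 m) (cchi 1 m));
    try by move=> x /(suppB m)[].
  rewrite -Rintegral_support; last by move=> x /(suppB m)[_ -> _]; rewrite mulr0.
  rewrite (@Rintegral_support _ _ a (c + e m *+ 2)); last first.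
    by move=> x /(supp m)[_ -> _]; rewrite mulr0.
  rewrite (weak_derivative_itv wh (Dchi 1 m) (cchi 2 m)) ?opprK//.
    by move=> x /(supp m)[].
  by move=> x /(supp m)[].
have chi1 m x : `|chi 3 m x| <= 1.
  have := @bspline3_lip _ (e m) (x - b) (x - a) (e0 m).
  have := @bspline3_lip _ (e m) (x - c) (x - b) (e0 m).
  rewrite !lerD2l !lerN2 => /(_ (ltW bc)) + /(_ (ltW ab)).
  rewrite (_ : x - b - (x - c) = c - b); last by ring.
  rewrite (_ : x - a - (x - b) = b - a); last by ring.
  rewrite /chi; move: (_ - bspline 3 _ (x - c)) (_ - bspline 3 _ (x - b)) => p q.
  have cb0 : 0 < c - b by rewrite subr_gt0.
  have ba0 : 0 < b - a by rewrite subr_gt0.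
  move=> /andP[p0 p1] /andP[q0 q1].
  have : 0 <= p / (c - b) <= 1.
    by apply/andP; split; [rewrite divr_ge0 ?(ltW cb0)|rewrite ler_pdivrMr ?mul1r].
  have : 0 <= q / (b - a) <= 1.
    by apply/andP; split; [rewrite divr_ge0 ?(ltW ba0)|rewrite ler_pdivrMr ?mul1r].
  by move=> /andP[? ?] /andP[? ?]; rewrite ler_norml; apply/andP; split; lra.
have lim : \int[leb]_(x in `[a, B]) (phi x * chi 1 m x) @[m --> \oo] -->
    (phi a - phi b) / (b - a) - (phi b - phi c) / (c - b).
  have cB : c + 2 <= B by [].
  have bB : b + 2 <= B by rewrite lerD2r ltW.
  have aB : a + 2 <= B by rewrite lerD2r ltW// (lt_trans ab).
  have ac : a <= c by rewrite ltW// (lt_trans ab).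
  have la := bspline1_delta cphi (lexx a) aB.
  have lb := bspline1_delta cphi (ltW ab) bB.
  have lc := bspline1_delta cphi ac cB.
  have L := cvgB (cvgM (cvgB la lb) (cvg_cst (b - a)^-1))
                 (cvgM (cvgB lb lc) (cvg_cst (c - b)^-1)).
  apply: (cvg_trans _ (L _ _ _ _ _ _ _)); apply: near_eq_cvg; apply: nearW => m /=.
  have ci d : leb.-integrable `[a, B]
      (EFin \o (fun x => phi x * bspline 1 (e m) (x - d))).
    apply: integrable_continuous_itv => x; apply: cvgM; first exact: cphi.
    exact: continuous_bspline_shift.
  have cc d d' k : leb.-integrable `[a, B] (EFin \o (fun x =>
      (phi x * bspline 1 (e m) (x - d) - phi x * bspline 1 (e m) (x - d')) / k)).
    apply: integrable_continuous_itv => x; apply: cvgM; last exact: cvg_cst.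
    by apply: cvgB; (apply: cvgM; [exact: cphi|exact: continuous_bspline_shift]).
  have ciB d d' : leb.-integrable `[a, B] (EFin \o (fun x =>
      phi x * bspline 1 (e m) (x - d) - phi x * bspline 1 (e m) (x - d'))).
    apply: eq_integrable (cc d d' 1) => // x _.
    by rewrite /= divr1.
  pose I d := \int[leb]_(x in `[a, B]) (phi x * bspline 1 (e m) (x - d)).
  transitivity ((I a - I b) / (b - a) - (I b - I c) / (c - b)); first by [].
  rewrite -[X in X / _ - _]RintegralB// -[X in _ - X / _]RintegralB//.
  rewrite -!RintegralZr// -[LHS]RintegralB//.
  by apply: eq_Rintegral => x _; rewrite /chi /= -!mulrBr -!mulrA -mulrBr.
rewrite (_ : _ - _ = (phi a - phi b) / (b - a) - (phi b - phi c) / (c - b)); last by ring.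
have ac0 : 0 < (c - a) / 2 by rewrite divr_gt0// subr_gt0 (lt_trans ab).
apply: cvgr_to_le (cvg_norm lim) _; near=> m.
(* the support has length [c - a + 2 e m], hence the factor 2 in the bound *)
have ea : (e m) *+ 2 <= c - a.
  rewrite -[leLHS]mulr_natr -ler_pdivlMr// ltW//; near: m.
  exact: (near_infty_natSinv_lt (PosNum ac0)).
rewrite /= w.
have am : a <= c + e m *+ 2 by have := e0 m; rewrite mulr2n; lra.
apply: le_trans (Rintegral_le_bound am H0 _ _) _.
- have ih : leb.-integrable `[a, c + e m *+ 2] (EFin \o h).
    by apply: locally_integrable_itv; case: wh.
  suff : leb.-integrable `[a, c + e m *+ 2] ((EFin \o h) \* (EFin \o chi 3%N m))%E by [].
  apply: integrableMl => //.
  + by apply: measurable_funTS; apply: continuous_measurable_fun; exact: cchi.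
  + exists 1; split => // M M1 x _ /=; exact: le_trans (chi1 m x) (ltW M1).
- by apply: ae_lebW hH => x hx _; rewrite normrM -[H]mulr1 ler_pM.
- by rewrite mulr2n mulrDl -mulrDr ler_wpM2l//; lra.
Unshelve. all: by end_near. Qed.

(** * Upwind particle systems *)

Lemma within_continuousB (R : realType) (A : set R) (f g : R -> R) :
  {within A, continuous f} -> continuous g ->
  {within A, continuous (fun t => f t - g t)}.
Proof.
move=> /subspace_continuousP cf cg; apply/subspace_continuousP => t At.
apply: cvgB; first exact: cf.
by apply: cvg_within_filter; exact: cg.
Qed.

Lemma within_continuous_sum (R : realType) (A : set R) (I : Type) (s : seq I)
    (f : I -> R -> R) : (forall i, {within A, continuous (f i)}) ->
  {within A, continuous (fun t => \sum_(i <- s) f i t)}.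
Proof.
move=> cf; apply/subspace_continuousP => t At.
rewrite /from_subspace; elim: s => [|i s IH].
  by rewrite big_nil; under eq_fun do rewrite big_nil; exact: cvg_cst.
rewrite big_cons; under eq_fun do rewrite big_cons.
by apply: cvgD => //; have /subspace_continuousP := cf i; exact.
Qed.

Lemma is_derive_expRM (R : realType) (c t : R) :
  is_derive t 1 (fun s : R => expR (c * s)) (c * expR (c * t)).
Proof.
have Dg : is_derive t 1 (fun s : R => c * s) c.
  apply: (is_derive_eq (is_deriveZ c (is_derive_id t (1 : R)))).
  by rewrite -[_ *: _]/(_ * _) mulr1.
by have := is_derive1_comp (is_derive_expR (c * t)) Dg; rewrite mulrC.
Qed.

(** The common form of the four systems: a particle pushed to the right
    adjusts its speed to the cell on its right, and a particle pushed to the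
    left to the cell on its left; the vacuum cells give the outermost particles
    the maximal speed.  The maxima are the positive and negative parts of
    [phi]. *)
Definition upwind_solution (R : realType) (v phi : R -> R) (n : nat)
    (x : nat -> R -> R) : Prop :=
  [/\ forall (i : nat) (t : R), (i < n)%N -> 0 <= t -> x i t < x i.+1 t,
      forall i : nat, (i <= n)%N -> {within `[0, +oo[, continuous (x i)} &
      forall (i : nat) (t : R), (i <= n)%N -> 0 < t ->
        is_derive t 1 (x i)
          (v (cell_density n x i.+1 t) * Num.max (phi (x i t)) 0 -
           v (cell_density n x i t) * Num.max (- phi (x i t)) 0)].

Section upwind.
Variables (R : realType) (v phi : R -> R) (n : nat) (x : nat -> R -> R).
Implicit Types (t : R) (i j : nat).

Local Notation r := (cell_density n x).

Definition slope t j : R := (phi (x j t) - phi (x j.-1 t)) / (x j t - x j.-1 t).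

(** The derivative of a cell density is the sum of two terms: [stretching] is
    the effect of a cell that moves at the speed given by its own density in the
    field [phi], and [transport] comes from the difference between this speed
    and the speeds dictated by the neighbouring cells. *)
Definition stretching t j : R := - (r j t * v (r j t) * slope t j).

Definition transport t j : R := n%:R * r j t ^+ 2 *
  (Num.max (phi (x j t)) 0 * (v (r j t) - v (r j.+1 t)) +
   Num.max (- phi (x j.-1 t)) 0 * (v (r j t) - v (r j.-1 t))).

Lemma cell_density0 t : r 0%N t = 0. Proof. by []. Qed.

Lemma cell_density_out j t : (n < j)%N -> r j t = 0.
Proof. by rewrite /cell_density [(j <= n)%N]leqNgt => ->; rewrite andbF. Qed.

Lemma cell_densityn t : r n.+1 t = 0. Proof. exact: cell_density_out. Qed.

Lemma cell_densityE j t : (j < n)%N -> r j.+1 t = n%:R^-1 / (x j.+1 t - x j t).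
Proof. by move=> jn; rewrite /cell_density/= jn. Qed.

Hypothesis sol : upwind_solution v phi n x.

Lemma cell_density_gt0 j t : (j < n)%N -> 0 <= t -> 0 < r j.+1 t.
Proof.
move=> jn t0; rewrite cell_densityE//; case: sol => lt _ _.
by rewrite divr_gt0 ?subr_gt0 ?lt// invr_gt0 ltr0n (leq_ltn_trans _ jn).
Qed.

Lemma cell_density_ge0 j t : 0 <= t -> 0 <= r j t.
Proof.
move=> t0; case: j => [|j]; first by rewrite cell_density0.
have [jn|nj] := ltnP j n; first by rewrite ltW// cell_density_gt0.
by rewrite cell_density_out.
Qed.

Lemma continuous_cell_density j : {within `[0, +oo[, continuous (r j)}.
Proof.
case: j => [|j]; first exact: cst_continuous.
have [jn|nj] := ltnP j n; last first.
  rewrite (_ : r j.+1 = cst 0); first exact: cst_continuous.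
  by apply/funext => t; rewrite cell_density_out.
rewrite (_ : r j.+1 = fun t => n%:R^-1 / (x j.+1 t - x j t)); last first.
  by apply/funext => t; rewrite cell_densityE.
case: sol => lt cx _.
apply/subspace_continuousP => t; rewrite /= in_itv/= andbT => t0.
have cj k : (k <= n)%N -> x k @ within `[0, +oo[ (nbhs t) --> x k t.
  by move=> kn; apply: (subspace_continuousP _ _).1; [exact: cx|rewrite /= in_itv/= t0].
apply: cvgM; first exact: cvg_cst.
apply: cvgV; first by rewrite gt_eqF// subr_gt0 lt.
by apply: cvgB; apply: cj => //; exact: ltnW.
Qed.

Lemma is_derive_cell_density j t : (j <= n.+1)%N -> 0 < t ->
  is_derive t 1 (r j) (transport t j + stretching t j).
Proof.
move=> jn t0; have [jb|] := boolP ((j == 0%N) || (j == n.+1)).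
  have rj (s : R) : r j s = 0.
    by case/orP : jb => /eqP ->; rewrite ?cell_density0 ?cell_densityn.
  rewrite (_ : cell_density n x j = cst 0); last exact/funext.
  rewrite /transport /stretching !rj expr0n/= mulr0 !mul0r oppr0 addr0.
  exact: is_derive_cst.
rewrite negb_or; case: j jn => [|j]//= jn; rewrite eqSS => jn'.
have {jn jn'} jn : (j < n)%N by rewrite ltn_neqAle jn' -ltnS.
have [lt _ dx] := sol.
have n0 : (n%:R : R) != 0 by rewrite pnatr_eq0 -lt0n (leq_ltn_trans _ jn).
have X0 : x j.+1 t - x j t != 0 by rewrite gt_eqF// subr_gt0 lt// ltW.
have D1 := dx j.+1 t jn t0; have D0 := dx j t (ltnW jn) t0.
have DX := is_deriveB D1 D0.
have DV := @is_deriveV _ (x j.+1 - x j) t _ _ X0 DX.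
have DR := is_deriveZ n%:R^-1 DV.
rewrite (_ : r j.+1 = n%:R^-1 \*: (fun y => ((x j.+1 - x j) y)^-1)); last first.
  by apply/funext => s; rewrite cell_densityE.
apply: (is_derive_eq DR).
have posneg (p : R) : p = Num.max p 0 - Num.max (- p) 0.
  by case: (leP p 0); case: (leP (- p) 0); lra.
rewrite /transport /stretching /slope -[_ *: _]/(_ * (_ * _)) /=.
have /= E1 := posneg (phi (x j.+1 t)); have /= E0 := posneg (phi (x j t)).
have rE := cell_densityE t jn.
move: (Num.max (phi (x j.+1 t)) 0) (Num.max (- phi (x j.+1 t)) 0) E1 => P1 N1 ->.
move: (Num.max (phi (x j t)) 0) (Num.max (- phi (x j t)) 0) E0 => P0 N0 ->.
move: (v (r j.+2 t)) (v (r j.+1 t)) (v (r j t)) => v2 v1 v0.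
rewrite rE -[(x j.+1 - x j) t]/(x j.+1 t - x j t).
by field; rewrite n0 X0.
Qed.

Hypothesis v_ge0 : forall p : R, 0 <= p -> 0 <= v p.
Hypothesis v_nincr : forall p q : R, 0 <= p -> p <= q -> v q <= v p.
Variable L : R.
Hypothesis phi_lip : forall a b : R, `|phi b - phi a| <= L * `|b - a|.

Lemma slope_le t j : (j < n)%N -> 0 <= t -> `|slope t j.+1| <= L.
Proof.
move=> jn t0; have [lt _ _] := sol.
have X0 : 0 < x j.+1 t - x j t by rewrite subr_gt0 lt.
rewrite /slope/= normrM normfV ler_pdivrMr ?normr_gt0 ?gt_eqF//.
Qed.

Lemma stretching_le t j : (j <= n.+1)%N -> 0 <= t ->
  `|stretching t j| <= v 0 * L * r j t.
Proof.
move=> jn t0; have [jb|] := boolP ((j == 0%N) || (j == n.+1)).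
  have rj : r j t = 0.
    by case/orP : jb => /eqP ->; rewrite ?cell_density0 ?cell_densityn.
  by rewrite /stretching rj !mul0r oppr0 normr0 mulr0.
rewrite negb_or; case: j jn => [|j]//= jn; rewrite eqSS => jn'.
have {jn jn'} jn : (j < n)%N by rewrite ltn_neqAle jn' -ltnS.
have r0 := cell_density_ge0 j.+1 t0.
rewrite /stretching normrN normrM [`|_ * v _|]normrM (ger0_norm r0).
rewrite (ger0_norm (v_ge0 r0)).
rewrite [leRHS]mulrC -mulrA ler_wpM2l// ler_pM ?v_ge0// ?v_nincr//.
exact: slope_le.
Qed.

(** A particle that leaves the densest cell takes its speed from a less dense
    one, hence moves at least as fast as the cell itself and dilates it. *)
Lemma transport_le0 t j : 0 <= t -> (forall k, r k t <= r j t) ->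
  transport t j <= 0.
Proof.
move=> t0 rj; have r0 k := cell_density_ge0 k t0.
rewrite /transport mulr_ge0_le0 ?mulr_ge0 ?sqr_ge0//.
rewrite -[leRHS](addr0 0) lerD// mulr_ge0_le0 ?le_max ?lexx ?orbT//.
  by rewrite subr_le0 v_nincr.
by rewrite subr_le0 v_nincr.
Qed.

(** At the densest cell the transport term only decreases the density, so the
    maximum grows at rate at most [v 0 * L].  The factor [2 - expR (- t)] makes
    the growth of the barrier strictly faster, while keeping it within a
    constant multiple of [expR (v 0 * L * t)]. *)
Lemma cell_density_upper_bound (M : R) : (forall j, r j 0 < M) ->
  forall j t, 0 <= t -> r j t <= 2 * M * expR (v 0 * L * t).
Proof.
move=> rM; have M0 : 0 < M by have := rM 0%N; rewrite cell_density0.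
set K := v 0 * L.
(* that is, [M * expR (K * s) * (2 - expR (- s))] *)
pose b (s : R) := M * (2 * expR (K * s) - expR ((K - 1) * s)).
pose db (s : R) := M * (2 * (K * expR (K * s)) - (K - 1) * expR ((K - 1) * s)).
have Db (s : R) : is_derive s 1 b (db s).
  have DD := is_deriveZ M (is_deriveB (is_deriveZ 2 (is_derive_expRM K s))
    (is_derive_expRM (K - 1) s)).
  exact: (is_derive_eq DD).
have bM (s : R) : b s <= 2 * M * expR (K * s).
  rewrite /b (_ : 2 * M * _ = M * (2 * expR (K * s))); last by ring.
  by apply: ler_wpM2l; [exact: ltW|rewrite gerBl expR_ge0].
have dbb (s : R) : db s = K * b s + M * expR ((K - 1) * s) by rewrite /db /b; ring.
suff H : forall (j : 'I_n.+2) (t : R), 0 <= t -> r j t - b t < 0.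
  move=> j t t0; have [jn|nj] := ltnP j n.+2.
    by apply: le_trans (bM t); rewrite -subr_le0 ltW// (H (Ordinal jn)).
  rewrite cell_density_out; last exact: ltnW.
  by rewrite !mulr_ge0 ?expR_ge0// ltW.
apply: first_touch => [j|j|t j t0 ler rb].
- apply: within_continuousB; first exact: continuous_cell_density.
  exact: is_derive_continuous Db.
- by rewrite /b !mulr0 expR0 mulr1 (_ : 2 - 1 = 1) ?mulr1 ?subr_lt0//; ring.
have jn : (j <= n.+1)%N by rewrite -ltnS.
exists (transport t j + stretching t j - db t).
  exact: is_deriveB (is_derive_cell_density jn t0) (Db t).
have t0' := ltW t0.
have rbE : r j t = b t by apply/eqP; rewrite -subr_eq0 rb.
have tr0 : transport t j <= 0.
  apply: transport_le0 => // k; rewrite rbE.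
  have [kn|nk] := ltnP k n.+2; first by rewrite -subr_le0 (ler (Ordinal kn)).
  rewrite cell_density_out -?rbE; last exact: ltnW.
  exact: cell_density_ge0.
have st := le_trans (ler_norm _) (stretching_le jn t0').
rewrite rbE -/K in st.
have : 0 < M * expR ((K - 1) * t) by rewrite mulr_gt0 ?expR_gt0.
by rewrite dbb; lra.
Qed.

Hypothesis L_ge0 : 0 <= L.
Variables Lv H : R.
Hypotheses (Lv_ge0 : 0 <= Lv) (H_ge0 : 0 <= H).
Hypothesis v_lip : forall p q : R, 0 <= p -> 0 <= q ->
  `|v q - v p| <= Lv * `|q - p|.
Hypothesis phi_dd : forall a b c : R, a < b -> b < c ->
  `|(phi c - phi b) / (c - b) - (phi b - phi a) / (b - a)| <= H * (c - a).

Lemma flux_lip (M p q : R) : 0 <= p -> 0 <= q -> p <= M ->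
  `|q * v q - p * v p| <= (v 0 + Lv * M) * `|q - p|.
Proof.
move=> p0 q0 pM.
rewrite (_ : _ - _ = (q - p) * v q + p * (v q - v p)); last by ring.
apply: le_trans (ler_normD _ _) _; rewrite !normrM mulrDl lerD//.
  by rewrite mulrC ler_wpM2r// ger0_norm ?v_ge0// v_nincr.
rewrite (ger0_norm p0) (le_trans (ler_wpM2l p0 (v_lip p0 q0)))//.
by rewrite mulrCA -[leRHS]mulrA ler_wpM2l// ler_wpM2r.
Qed.

(** The increment of the product flux times slope splits into an increment of
    the flux and an increment of the slope.  The latter is bounded by the width
    of the two cells involved; choosing the splitting in which it is multiplied
    by the smaller density [m] makes this term of order [1 / n], since [m] times
    the width of either cell is at most the mass [1 / n] of that cell. *)
Lemma stretching_increment (M : R) t i : (i <= n)%N -> (0 < n)%N -> 0 <= t ->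
  (forall j, r j t <= M) ->
  `|stretching t i.+1 - stretching t i| <=
    L * (v 0 + Lv * M) * `|r i.+1 t - r i t| + 2 * H * v 0 / n%:R.
Proof.
move=> ni n0 t0 rM; have [lt _ _] := sol.
have v00 : 0 <= v 0 by rewrite v_ge0.
have M0 : 0 <= M by rewrite (le_trans _ (rM 0%N)) ?cell_density0.
have n0' : 0 < (n%:R : R) by rewrite ltr0n.
have c0 : 0 <= 2 * H * v 0 / n%:R by rewrite !mulr_ge0// invr_ge0 ltW.
have edge j : (j <= n.+1)%N -> `|stretching t j| <= L * (v 0 + Lv * M) * `|r j t|.
  move=> jn; apply: le_trans (stretching_le jn t0) _.
  rewrite (ger0_norm (cell_density_ge0 _ t0)) ler_wpM2r ?cell_density_ge0//.
  by rewrite mulrC ler_wpM2l// lerDl mulr_ge0.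
have out j : r j t = 0 -> stretching t j = 0.
  by rewrite /stretching => ->; rewrite !mul0r oppr0.
case: i ni => [|i] ni.
  rewrite (out 0%N) ?cell_density0// !subr0 (le_trans (edge 1%N _))//.
  by rewrite lerDl.
have [iE|iN] := eqVneq i.+1 n.
  rewrite (out i.+2) iE ?cell_densityn// ![`|0 - _|]distrC !subr0.
  rewrite (le_trans (edge n _))//.
  by rewrite lerDl.
have {ni iN} i2n : (i.+1 < n)%N by rewrite ltn_neqAle iN.
have i1n := ltnW i2n.
have ab := lt _ _ i1n t0; have bc := lt _ _ i2n t0.
have DD := phi_dd ab bc; have D1 := slope_le i1n t0; have D2 := slope_le i2n t0.
have p0 := cell_density_gt0 i1n t0; have q0 := cell_density_gt0 i2n t0.
have pE := cell_densityE t i1n; have qE := cell_densityE t i2n.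
have pM := rM i.+1; have qM := rM i.+2.
have F1 := flux_lip (ltW p0) (ltW q0) pM.
rewrite /stretching; move: DD D1 D2; rewrite -[X in `|X - _|]/(slope t i.+2).
rewrite -[X in `|_ - X|]/(slope t i.+1).
have pX : r i.+1 t * (x i.+1 t - x i t) = n%:R^-1.
  by rewrite pE divfK// gt_eqF// subr_gt0.
have qX : r i.+2 t * (x i.+2 t - x i.+1 t) = n%:R^-1.
  by rewrite qE divfK// gt_eqF// subr_gt0.
have vp := v_ge0 (ltW p0); have vq := v_ge0 (ltW q0).
have vp0 := v_nincr (lexx 0) (ltW p0); have vq0 := v_nincr (lexx 0) (ltW q0).
move: (r i.+1 t) (r i.+2 t) (slope t i.+1) (slope t i.+2)
  p0 q0 pM qM F1 pX qX vp vq vp0 vq0 => p q D D' {pE qE}.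
move=> p0 q0 pM qM F1 pX qX vp vq vp0 vq0 DD D1 D2.
have small m : 0 <= m -> m <= p -> m <= q -> 0 <= v m -> v m <= v 0 ->
    `|m * v m * (D' - D)| <= 2 * H * v 0 / n%:R.
  move=> m0 mp mq vm vm0.
  rewrite normrM normrM (ger0_norm m0) (ger0_norm vm).
  have mX : m * (x i.+2 t - x i t) <= 2 / n%:R.
    rewrite (_ : x i.+2 t - x i t =
      (x i.+1 t - x i t) + (x i.+2 t - x i.+1 t)); last by ring.
    rewrite mulrDr (_ : 2 / n%:R = n%:R^-1 + n%:R^-1); last by ring.
    by rewrite -{1}pX -{1}qX lerD// ler_wpM2r// subr_ge0 ltW.
  apply: (@le_trans _ _ (m * v 0 * (H * (x i.+2 t - x i t)))).
    by apply: ler_pM => //; rewrite ?mulr_ge0// ler_wpM2l.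
  rewrite (_ : m * v 0 * _ = H * v 0 * (m * (x i.+2 t - x i t))); last by ring.
  rewrite (_ : 2 * H * v 0 / _ = H * v 0 * (2 / n%:R)); last by ring.
  by rewrite ler_wpM2l// mulr_ge0.
have big E : `|E| <= L -> `|(q * v q - p * v p) * E| <= L * (v 0 + Lv * M) * `|q - p|.
  move=> EL; rewrite normrM mulrC -mulrA ler_pM// mulr_ge0//.
have [pq|qp] := leP p q.
  rewrite (_ : _ - _ = - ((q * v q - p * v p) * D' + p * v p * (D' - D))); last by ring.
  by rewrite normrN (le_trans (ler_normD _ _))// lerD// ?big// small// ltW.
rewrite (_ : _ - _ = - ((q * v q - p * v p) * D + q * v q * (D' - D))); last by ring.
by rewrite normrN (le_trans (ler_normD _ _))// lerD// ?big// small// ltW.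
Qed.

(** If [s'] realizes the absolute value of [q - p], then [s - s'] and [q - p]
    have opposite signs whenever [|s| <= 1], whatever [s] is. *)
Lemma saturated_sign (s s' p q : R) : `|s| <= 1 -> 0 <= p -> 0 <= q ->
  s' * (q - p) = `|q - p| -> (s - s') * (v p - v q) <= 0.
Proof.
rewrite ler_norml => /andP[s1 s2] p0 q0.
have [pq|qp|->] := ltgtP p q; last by rewrite [v q - _]subrr mulr0.
  rewrite gtr0_norm ?subr_gt0// => s'E.
  have -> : s' = 1.
    by apply: (@mulIf _ (q - p)); rewrite ?mul1r// gt_eqF// subr_gt0.
  by rewrite mulr_le0_ge0 ?subr_le0// subr_ge0 v_nincr// ltW.
rewrite ltr0_norm ?subr_lt0// => s'E.
have -> : s' = -1.
  by apply: (@mulIf _ (q - p)); rewrite ?mulN1r// lt_eqF// subr_lt0.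
by apply: mulr_ge0_le0; [lra|rewrite subr_le0 v_nincr// ltW].
Qed.

(** After summation by parts, each cell contributes a difference of two signs
    times speed differences across its two ends.  Since [v] is nonincreasing and
    each sign is saturated at its own end, every contribution is nonpositive:
    upwinding does not increase the total variation. *)
Lemma transport_sum_le0 (s : nat -> R) t : 0 <= t -> (forall i, `|s i| <= 1) ->
  (forall i, (i <= n)%N -> s i * (r i.+1 t - r i t) = `|r i.+1 t - r i t|) ->
  \sum_(i < n.+1) s i * (transport t i.+1 - transport t i) <= 0.
Proof.
move=> t0 s1 sE; have r0 k := cell_density_ge0 k t0.
have tr0 : transport t 0 = 0 by rewrite /transport cell_density0 expr0n mulr0 mul0r.
have trn : transport t n.+1 = 0 by rewrite /transport cell_densityn expr0n mulr0 mul0r.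
rewrite (sum_by_parts s tr0 trn); apply: sumr_le0 => i _.
have iln := ltn_ord i.
rewrite /transport/= mulrCA mulr_ge0_le0 ?mulr_ge0 ?sqr_ge0//.
rewrite mulrDr -[leRHS](addr0 0) lerD//.
  rewrite mulrCA mulr_ge0_le0 ?le_max ?lexx ?orbT//.
  exact: saturated_sign (sE i.+1 iln).
rewrite mulrCA mulr_ge0_le0 ?le_max ?lexx ?orbT//.
rewrite -opprB mulNr -mulrN opprB.
apply: saturated_sign => //; exact: (sE i (ltnW iln)).
Qed.

(** A Gronwall argument for the sum of the absolute values of the jumps, viewed
    as the maximum over all sign vectors [s] of the differentiable functions
    [\sum_i s i * (r i.+1 - r i)].  The barrier [W] solves a linear
    differential inequality whose rate dominates the rate [c] of the stretching
    terms.  The constant 1 added to [V0] makes the initial comparison strict. *)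
Lemma total_jump_bound (V0 : R) : (0 < n)%N ->
  \sum_(i < n.+1) `|r i.+1 0 - r i 0| <= V0 ->
  let L' := v 0 * L in
  let gamma := L * v 0 + 2 * L * Lv * (V0 + 1) + 1 in
  let zeta := 2 * L * Lv * (V0 + 1) / L' + 1 in
  forall t, 0 <= t -> \sum_(i < n.+1) `|r i.+1 t - r i t| <=
    (V0 + 1 + (4 * H * v 0 + 1) * t) * expR (gamma * t + zeta * expR (L' * t)).
Proof.
move=> n0 jump0 L' gamma zeta.
have v00 : 0 <= v 0 by rewrite v_ge0.
have V00 : 0 <= V0 by rewrite (le_trans _ jump0)// sumr_ge0.
have L'0 : 0 <= L' by rewrite mulr_ge0.
have r0V j : r j 0 < V0 + 1.
  have [jn|nj] := leqP j n; last by rewrite cell_density_out// ltr_wpDl.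
  suff : r j 0 <= V0 by move=> /le_lt_trans; apply; rewrite ltrDl.
  apply: le_trans jump0.
  have -> : r j 0 = \sum_(0 <= i < j) (r i.+1 0 - r i 0).
    by rewrite telescope_sumr// cell_density0 subr0.
  rewrite -(big_mkord xpredT (fun i => `|r i.+1 0 - r i 0|)).
  rewrite (big_cat_nat (leq0n j) (leqW jn))/=.
  apply: (@le_trans _ _ (\sum_(0 <= i < j) `|r i.+1 0 - r i 0|)).
    by apply: ler_sum => i _; exact: ler_norm.
  by rewrite lerDl sumr_ge0.
have rM := cell_density_upper_bound r0V.
pose K := 2 * L * Lv * (V0 + 1).
have K0 : 0 <= K by rewrite !mulr_ge0// addr_ge0.
have gE : gamma = L * v 0 + K + 1 by [].
have zE : zeta = K / L' + 1 by [].
have Lv0 : 0 <= L * v 0 by rewrite mulr_ge0.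
have g0 : 0 <= gamma by rewrite gE !addr_ge0.
have z0 : 0 <= zeta by rewrite zE addr_ge0 ?divr_ge0.
pose Gam (s : R) := gamma * s + zeta * expR (L' * s).
pose dGam (s : R) := gamma + zeta * (L' * expR (L' * s)).
pose al := 4 * H * v 0 + 1.
have al0 : 0 <= al by rewrite addr_ge0 ?mulr_ge0.
pose P (s : R) := V0 + 1 + al * s.
pose W (s : R) := P s * expR (Gam s).
pose dW (s : R) := P s * (expR (Gam s) * dGam s) + expR (Gam s) * al.
have DGam (s : R) : is_derive s 1 Gam (dGam s).
  have DD := is_deriveD (is_deriveZ gamma (is_derive_id s (1 : R)))
    (is_deriveZ zeta (is_derive_expRM L' s)).
  by apply: (is_derive_eq DD); rewrite -[gamma *: _]/(_ * _) mulr1.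
have DP (s : R) : is_derive s 1 P al.
  have DD := is_deriveD (is_derive_cst (V0 + 1) s (1 : R))
    (is_deriveZ al (is_derive_id s (1 : R))).
  by apply: (is_derive_eq DD); rewrite -[al *: _]/(_ * _) mulr1 (add0r al).
have DW (s : R) : is_derive s 1 W (dW s).
  have DE := is_derive1_comp (is_derive_expR (Gam s)) (DGam s).
  exact: (is_deriveM (DP s) DE).
have dGamE (s : R) : 0 <= s ->
    L * (v 0 + Lv * (2 * (V0 + 1) * expR (L' * s))) <= dGam s.
  move=> s0; rewrite /dGam gE zE.
  rewrite (_ : L * _ = L * v 0 + K * expR (L' * s)); last by rewrite /K; ring.
  rewrite -!addrA lerD2l.
  (* [zeta] is of use only if [L' != 0]; otherwise the exponential is 1 and the
     term [K] of [gamma] suffices *)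
  have [L0|L1] := eqVneq L' 0.
    by rewrite L0 !mul0r expR0 mulr1 mulr0 addr0 lerDl.
  rewrite mulrA mulrDl divfK// mul1r mulrDl.
  by rewrite ler_wpDl// ler_wpDl// lerDl mulr_ge0// expR_ge0.
have GamE (s : R) : 0 <= s -> 0 <= Gam s.
  by move=> s0; rewrite addr_ge0 ?mulr_ge0 ?expR_ge0.
have P0 (s : R) : 0 <= s -> 0 <= P s.
  by move=> s0; rewrite !addr_ge0 ?mulr_ge0.
have W0 : V0 < W 0.
  rewrite /W /P mulr0 addr0 (@lt_le_trans _ _ (V0 + 1)) ?ltrDl//.
  by rewrite ler_peMr ?addr_ge0// -expR0 ler_expR GamE.
pose sg (s : {ffun 'I_n.+1 -> bool}) (i : nat) : R := (-1) ^+ (s (inord i)).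
have sg1 s i : `|sg s i| <= 1 by rewrite /sg normr_sign.
have sgle s i (z : R) : sg s i * z <= `|z|.
  by rewrite (le_trans (ler_norm _))// normrM normr_sign mul1r.
suff key : forall (s : {ffun 'I_n.+1 -> bool}) (t : R), 0 <= t ->
    \sum_(i < n.+1) sg s i * (r i.+1 t - r i t) - W t < 0.
  move=> t t0; pose s := [ffun i : 'I_n.+1 => r i.+1 t - r i t < 0].
  rewrite -/(Gam t) -/al -/(P t) -/(W t) -subr_le0 ltW//.
  rewrite (le_lt_trans _ (key s t t0))// lerD2r; apply: ler_sum => i _.
  rewrite /sg inord_val ffunE.
  case: (ltP (r i.+1 t - r i t) 0) => z0'; first by rewrite ltr0_norm// mulN1r.
  by rewrite ger0_norm// mul1r.
apply: first_touch => [s|s|t s t0 le0 st].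
- apply: within_continuousB; last exact: is_derive_continuous DW.
  apply: within_continuous_sum => i; apply/subspace_continuousP => t At.
  apply: cvgM; first exact: cvg_cst.
  have /subspace_continuousP c1 := @continuous_cell_density i.+1.
  have /subspace_continuousP c0 := @continuous_cell_density i.
  by apply: cvgB; [exact: c1|exact: c0].
- rewrite subr_lt0 (le_lt_trans _ W0)// (le_trans _ jump0)//.
  by apply: ler_sum => i _; exact: sgle.
have t0' := ltW t0.
pose sgz : {ffun 'I_n.+1 -> bool} := [ffun i : 'I_n.+1 => r i.+1 t - r i t < 0].
have sgzE (i : 'I_n.+1) : sg sgz i * (r i.+1 t - r i t) = `|r i.+1 t - r i t|.
  rewrite /sg inord_val ffunE.
  case: (ltP (r i.+1 t - r i t) 0) => zi; first by rewrite ltr0_norm// mulN1r.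
  by rewrite ger0_norm// mul1r.
have sumW : \sum_(i < n.+1) sg s i * (r i.+1 t - r i t) = W t.
  by apply/eqP; rewrite -subr_eq0 st.
(* the touching sign vector realizes the maximum, so each of its signs is
   saturated *)
have gap0 : \sum_(i < n.+1)
    (`|r i.+1 t - r i t| - sg s i * (r i.+1 t - r i t)) = 0.
  apply/eqP; rewrite eq_le; apply/andP; split; last first.
    by apply: sumr_ge0 => i _; rewrite subr_ge0 sgle.
  rewrite sumrB sumW subr_le0; have := le0 sgz; rewrite subr_le0.
  by apply: le_trans; apply: ler_sum => i _; rewrite sgzE.
have sE i : (i <= n)%N -> sg s i * (r i.+1 t - r i t) = `|r i.+1 t - r i t|.
  move=> ni; have := psumr_eq0P _ gap0 => /(_ _ (inord i)).
  rewrite inordK// => H0; apply/esym/eqP; rewrite -subr_eq0 H0// => k _.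
  by rewrite subr_ge0 sgle.
have sumE : \sum_(i < n.+1) `|r i.+1 t - r i t| = W t.
  by rewrite -sumW; apply: eq_bigr => i _; rewrite sE// -ltnS.
pose dr j := transport t j + stretching t j.
exists (\sum_(i < n.+1) sg s i * (dr i.+1 - dr i) - dW t).
  have Dr (i : 'I_n.+1) : is_derive t 1 (fun y : R => sg s i * (r i.+1 y - r i y))
      (sg s i * (dr i.+1 - dr i)).
    have D1 := is_derive_cell_density (ltn_ord i) t0.
    have D0 := is_derive_cell_density (ltnW (ltn_ord i)) t0.
    exact: (is_derive_eq (is_deriveZ (sg s i) (is_deriveB D1 D0))).
  have DS := is_derive_sum Dr.
  have DD := is_deriveB DS (DW t).
  move: DD; rewrite (_ : \sum_(i < n.+1) _ =
    fun y : R => \sum_(i < n.+1) sg s i * (r i.+1 y - r i y))//.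
  by apply/funext => y; rewrite fct_sumE.
have kbound : n.+1%:R * (2 * H * v 0 / n%:R) <= 4 * H * v 0.
  rewrite mulrCA (_ : 4 * H * v 0 = 2 * H * v 0 * 2); last by ring.
  rewrite ler_wpM2l ?mulr_ge0// ler_pdivrMr ?ltr0n// -natrM ler_nat.
  by rewrite mul2n -addnn -addn1 leq_add2l.
pose c := L * (v 0 + Lv * (2 * (V0 + 1) * expR (L' * t))).
have sB : \sum_(i < n.+1) sg s i * (stretching t i.+1 - stretching t i) <=
    c * W t + 4 * H * v 0.
  apply: (@le_trans _ _ (\sum_(i < n.+1)
      (c * `|r i.+1 t - r i t| + 2 * H * v 0 / n%:R))).
    apply: ler_sum => i _; apply: le_trans (sgle _ _ _) _.
    apply: stretching_increment => //; first by rewrite -ltnS.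
    by move=> j; exact: rM.
  rewrite big_split/= -mulr_sumr sumE lerD2l sumr_const card_ord.
  by rewrite -[leLHS]mulr_natl.
have sA := transport_sum_le0 t0' (sg1 s) sE.
have cW : c * W t <= P t * (expR (Gam t) * dGam t).
  rewrite /W mulrCA ler_wpM2l ?P0// mulrC ler_wpM2l ?expR_ge0//.
  exact: dGamE.
have E1 : al <= expR (Gam t) * al.
  by rewrite ler_peMl// -expR0 ler_expR GamE.
rewrite /dW.
rewrite (_ : \sum_(i < n.+1) sg s i * (dr i.+1 - dr i) =
  \sum_(i < n.+1) sg s i * (transport t i.+1 - transport t i) +
  \sum_(i < n.+1) sg s i * (stretching t i.+1 - stretching t i)); last first.
  by rewrite -big_split/=; apply: eq_bigr => i _; rewrite /dr; ring.
move: sA sB cW E1.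
move: (\sum_(i < n.+1) _) (\sum_(i < n.+1) _) => SA SB.
move: (P t * _) (expR _ * al) (c * _) => p q w.
by rewrite /al; move: (4 * H * v 0) => h; lra.
Qed.

End upwind.

(** * Initial variation *)

Lemma ae_exists (R : realType) (P : R -> Prop) (a b : R) : a < b ->
  {ae leb, forall x, P x} -> exists2 x, a < x < b & P x.
Proof.
move=> ab [N [mN N0 NP]]; apply: contrapT => noP.
have sub : `]a, b[%classic `<=` N.
  move=> x /=; rewrite in_itv/= => xab; apply: NP => /= Px.
  by apply: noP; exists x.
have : (leb `]a, b[%classic <= leb N)%E.
  by apply: le_measure; rewrite ?inE//.
rewrite N0.
have -> := lebesgue_measure_itv (Interval (BRight a) (BLeft b)).
by rewrite /= lte_fin ab -EFinD lee_fin subr_le0 leNgt ab.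
Qed.

Lemma sum_le_total_variation (R : realType) (g : R -> R) (y : nat -> R) (m : nat) :
  (forall i, (i < m)%N -> y i <= y i.+1) ->
  y 0%N <= y m /\ ((\sum_(i < m) `|g (y i.+1) - g (y i)|)%:E <=
  total_variation (y 0%N) (y m) g)%E.
Proof.
elim: m => [|m IH] le.
  by rewrite big_ord0 total_variationxx.
have [|le0 IHm] := IH; first by move=> i im; apply: le; exact: ltnW.
have lem := le m (ltnSn m).
split; first exact: le_trans lem.
rewrite (total_variationD g le0 lem) big_ord_recr/= EFinD leeD//.
exact: total_variation_ge.
Qed.

(** An integrable function cannot lie strictly on one side of its mean almost
    everywhere; the factor [s], through its sign, selects the side. *)
Lemma mean_point (R : realType) (f : R -> R) (p q m s : R) (P : R -> Prop) :
  p < q -> leb.-integrable `[p, q] (EFin \o f) ->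
  \int[leb]_(x in `[p, q]) f x = m * (q - p) ->
  {ae leb, forall x, P x} ->
  exists x, [/\ p < x < q, P x & s * m <= s * f x].
Proof.
move=> pq itf fm aeP; apply: contrapT => nox.
pose h x := s * (m - f x).
have hpos : {ae leb, forall x, p < x < q -> 0 < h x}.
  apply: ae_lebW aeP => x Px xpq; rewrite /h mulrBr subr_gt0 ltNge; apply/negP => le.
  by apply: nox; exists x.
have ioc : leb.-integrable `]p, q[ (EFin \o f).
  apply: (integrableS _ _ _ itf) => //; exact: subset_itv_oo_cc.
have fmo : \int[leb]_(x in `]p, q[) f x = m * (q - p).
  rewrite -fm Rintegral_itv_bndo_bndc// Rintegral_itv_obnd_cbnd//.
  by apply: (integrableS _ _ _ itf) => //; exact: subset_itv_oc_cc.
have muE : leb (`]p, q[%classic : set R) = (q - p)%:E.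
  have -> := lebesgue_measure_itv (Interval (BRight p) (BLeft q)).
  by rewrite /= lte_fin pq -EFinD.
have icst (k : R) : leb.-integrable `]p, q[ (EFin \o cst k).
  have icc : leb.-integrable `[p, q] (EFin \o cst k).
    by apply: integrable_continuous_itv; exact: cst_continuous.
  by apply: (integrableS _ _ _ icc) => //; exact: subset_itv_oo_cc.
have imf : leb.-integrable `]p, q[ (EFin \o (fun x => m - f x)).
  exact: (integrableB _ (icst m) ioc).
have ih : leb.-integrable `]p, q[ (EFin \o h).
  exact: (integrableZl _ s imf).
have h0 : \int[leb]_(x in `]p, q[) h x = 0.
  have cE : \int[leb]_(x in `]p, q[) (cst m x : R) = m * (q - p).
    by rewrite Rintegral_cst//; congr (_ * _); exact: (congr1 fine muE).
  have iB : \int[leb]_(x in `]p, q[) (m - f x) = 0.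
    by rewrite (RintegralB _ (icst m) ioc)// cE fmo subrr.
  by rewrite RintegralZl// iB mulr0.
have mh : measurable_fun `]p, q[ (EFin \o h) by case/integrableP : ih.
have abs0 : (\int[leb]_(x in `]p, q[) `|(EFin \o h) x| = 0)%E.
  apply: (etrans (@ae_eq_integral _ _ _ leb _ (EFin \o h)
    (abse \o (EFin \o h)) _ _ mh _)) => //.
  - exact: measurableT_comp.
  - apply: ae_lebW hpos => x hx /=; rewrite in_itv/= => /hx h0x.
    by rewrite ger0_norm// ltW.
  - apply: etrans (esym (fineK _)) _; first exact: (integrable_fin_num _ ih).
    exact: (congr1 EFin h0).
have hz := (ae_eq_integral_abs leb (measurable_itv _) mh).1 abs0.
have [x xpq [hx hx0]] := ae_exists pq (ae_leb2 hpos hz).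
have := hx xpq; have := hx0; rewrite /= in_itv/= => /(_ xpq) [->].
by rewrite ltxx.
Qed.

(** The complement of the essential support is covered by the countably many
    intervals with rational ends on which [rho] vanishes almost everywhere. *)
Lemma ae_outside_ess_support (R : realType) (rho : R -> R) :
  {ae leb, forall x, ess_support rho x \/ rho x = 0}.
Proof.
pose I (pq : rat * rat) : set R := `]ratr pq.1, ratr pq.2[%classic.
pose ok pq := `[< {ae leb, forall x, I pq x -> rho x = 0} >].
have aeI (pq : rat * rat) : {ae leb, forall x, ok pq -> I pq x -> rho x = 0}.
  have [/asboolP okpq|nok] := boolP (ok pq).
    by apply: ae_lebW okpq => x + _.
  by apply: aeW => x.
have aeN (m : nat) : {ae leb, forall x, forall pq, unpickle m = Some pq ->
    ok pq -> I pq x -> rho x = 0}.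
  case: (unpickle m : option (rat * rat)) => [pq|]; last by apply: aeW.
  by apply: ae_lebW (aeI pq) => x H pq' [<-].
have := ae_foralln aeN; apply: ae_lebW => x Hx.
have [|nS] := pselect (ess_support rho x); [by left|right].
have {nS} : [set x | exists2 U : set R, nbhs x U & rho = cst 0 %[ae leb in U]] x.
  by apply: contrapT => nU; apply: nS.
case=> U /nbhs_ballP[e /= e0 eU] rU.
have xl : x - e < x by rewrite ltrBlDr ltrDl.
have xr : x < x + e by rewrite ltrDl.
have [p] := rat_in_itvoo xl.
rewrite in_itv/= => /andP[p1 p2].
have [q] := rat_in_itvoo xr.
rewrite in_itv/= => /andP[q1 q2].
apply: (Hx (pickle (p, q)) (p, q)); first by rewrite pickleK.
  apply/asboolP; apply: ae_lebW rU => y Hy; rewrite /I/= in_itv/= => /andP[y1 y2].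
  apply: Hy; apply: eU; rewrite /ball/= ltr_norml; apply/andP; split; lra.
by rewrite /I/= in_itv/= p2.
Qed.

Lemma compact_has_bounds (R : realType) (A : set R) : compact A ->
  has_lbound A /\ has_ubound A.
Proof.
move=> /compact_bounded[M [_ MA]].
have AM x : A x -> `|x| <= M + 1 by move=> Ax; apply: (MA (M + 1)) => //; rewrite ltrDl.
split; [exists (- (M + 1))|exists (M + 1)] => x /AM; rewrite ler_norml => /andP[]//.
Qed.

Lemma ae_eq_Rintegral (R : realType) (D : set R) (f g : R -> R) :
  measurable D -> measurable_fun D f -> measurable_fun D g ->
  {ae leb, forall x, D x -> f x = g x} ->
  \int[leb]_(x in D) f x = \int[leb]_(x in D) g x.
Proof.
move=> mD mf mg fg; rewrite /Rintegral; congr fine; apply: ae_eq_integral => //.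
- exact/measurable_EFinP.
- exact/measurable_EFinP.
- by apply: ae_lebW fg => x H Dx; rewrite H.
Qed.

Section mass.
Variables (R : realType) (rho : R -> R).
Hypothesis hI : hyp_I rho.

Definition mass (y : R) : R := \int[leb]_(x in `]-oo, y]) rho x.

Lemma integrable_rho : leb.-integrable setT (EFin \o rho).
Proof. by case: hI => _ [/Lfun1_integrable]. Qed.

Lemma integrable_rho_sub (A : set R) : measurable A -> leb.-integrable A (EFin \o rho).
Proof. by move=> mA; apply: (integrableS _ _ _ integrable_rho). Qed.

Lemma measurable_rho (A : set R) : measurable_fun A rho.
Proof.
apply: measurable_funTS; case/integrableP : integrable_rho => + _.
by move=> /measurable_EFinP.
Qed.

Lemma mass_increment (a b : R) : a <= b ->
  \int[leb]_(x in `[a, b]) rho x = mass b - mass a.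
Proof.
move=> ab; rewrite -Rintegral_itv_obnd_cbnd; last exact: integrable_rho_sub.
by rewrite /mass Rintegral_itvB ?bnd_simp//; exact: integrable_rho_sub.
Qed.

Lemma mass_ndecr (a b : R) : a <= b -> mass a <= mass b.
Proof.
move=> ab; rewrite -subr_ge0 -mass_increment//.
have [_ _ ge0 _ _] := hI.
rewrite (@ae_eq_Rintegral _ _ _ (fun x => `|rho x|))//.
- exact: Rintegral_ge0.
- exact: measurable_rho.
- by apply: measurableT_comp => //; exact: measurable_rho.
by apply: ae_lebW ge0 => x r0 _; rewrite ger0_norm.
Qed.

Lemma mass_lipschitz : exists2 C : R, 0 <= C &
  forall a b : R, a <= b -> mass b - mass a <= C * (b - a).
Proof.
have [/Lfun_oo_bounded[C C0 rC] _ _ _ _] := hI; exists C => // a b ab.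
rewrite -mass_increment// (le_trans (ler_norm _))// Rintegral_le_bound//.
  exact: integrable_rho_sub.
by apply: ae_lebW rC.
Qed.

Lemma ess_support_itv x : ess_support rho x ->
  inf (ess_support rho) <= x <= sup (ess_support rho).
Proof.
have [_ _ _ /compact_has_bounds[lb ub] _] := hI => Sx.
by rewrite ge_inf// ub_le_sup.
Qed.

Lemma ae_rho_outside : {ae leb, forall x,
  ~~ (inf (ess_support rho) <= x <= sup (ess_support rho)) -> rho x = 0}.
Proof.
apply: ae_lebW (@ae_outside_ess_support _ rho) => x [/ess_support_itv ->//|//].
Qed.

Lemma mass_inf : mass (inf (ess_support rho)) = 0.
Proof.
rewrite /mass -Rintegral_itv_bndo_bndc; last exact: integrable_rho_sub.
rewrite (@ae_eq_Rintegral _ _ _ (cst 0))//; first by rewrite Rintegral_cst ?mul0r.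
  exact: measurable_rho.
apply: ae_lebW ae_rho_outside => x Hx /=; rewrite in_itv/= => xi.
by rewrite Hx// negb_and -ltNge xi.
Qed.

Lemma mass_sup : mass (sup (ess_support rho)) = 1.
Proof.
have [_ _ ge0 _ N1] := hI.
have -> : 1 = fine ('N[leb]_1[EFin \o rho])%E by rewrite N1.
rewrite Lnorm1 /mass Rintegral_mkcond.
apply: (@ae_eq_Rintegral _ setT _ (fun x => `|rho x|)) => //.
- apply/(measurable_restrictT _ _).1 => //; exact: measurable_rho.
- by apply: measurableT_comp => //; exact: measurable_rho.
apply: ae_lebW (ae_leb2 ge0 ae_rho_outside) => x [r0 Hx] _.
rewrite patchE mem_setE in_itv/=; case: ifPn => xs; first by rewrite ger0_norm.
by rewrite Hx ?normr0// negb_and orbC xs.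
Qed.

Lemma oriented_integral_mass (a b : R) :
  oriented_integral rho a b = mass b - mass a.
Proof.
rewrite /oriented_integral; case: (leP a b) => ab; first exact: mass_increment.
by rewrite mass_increment ?opprB// ltW.
Qed.

(** The mass is continuous, being Lipschitz, so the supremum of a strict
    sublevel set is a point where the level is attained. *)
Lemma mass_sup_lt (c a b : R) : mass a < c -> c < mass b ->
  mass (sup [set x | mass x < c]) = c.
Proof.
move=> ac cb; set S := [set x | _].
have hS : has_sup S.
  split; first by exists a.
  exists b => x; rewrite /S/= => xc; rewrite leNgt; apply/negP => /ltW/mass_ndecr.
  by rewrite leNgt (lt_trans xc cb).
have [C C0 lip] := mass_lipschitz.
have C1 : 0 < C + 1 by rewrite ltr_wpDl.
apply/eqP; rewrite eq_le; apply/andP; split.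
  apply/ler_addgt0Pr => e e0.
  have d0 : 0 < e / (C + 1) by rewrite divr_gt0.
  have [x Sx sx] := sup_adherent d0 hS.
  have xs : x <= sup S by apply: ub_le_sup => //; exact: (proj2 hS).
  have := lip _ _ xs; rewrite /S/= in Sx => H.
  have : C * (sup S - x) <= e.
    apply: (@le_trans _ _ ((C + 1) * (e / (C + 1)))); last first.
      by rewrite mulrC divfK// gt_eqF.
    by apply: ler_pM => //; rewrite ?subr_ge0 ?lerDl//; lra.
  by move: Sx H; lra.
rewrite leNgt; apply/negP => sc.
have d0 : 0 < (c - mass (sup S)) / (C + 1) by rewrite divr_gt0 ?subr_gt0.
set d := (c - _) / _ in d0.
have : S (sup S + d).
  rewrite /S/=; have := lip (sup S) (sup S + d); rewrite lerDl ltW// => /(_ erefl).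
  rewrite (_ : sup S + d - sup S = d); last by ring.
  have : (C + 1) * d = c - mass (sup S) by rewrite mulrC divfK// gt_eqF.
  by rewrite mulrDl mul1r; lra.
move=> Sd; have : sup S + d <= sup S by apply: ub_le_sup => //; exact: (proj2 hS).
by rewrite gerDl leNgt d0.
Qed.

Lemma mass_xbar_rec (n i : nat) : (i < n)%N ->
  mass (xbar_rec rho n i) = i%:R / n%:R.
Proof.
elim: i => [|i IH] ilt /=; first by rewrite mass_inf mul0r.
have n0 : 0 < (n%:R : R) by rewrite ltr0n (leq_ltn_trans _ ilt).
have mi := IH (ltnW ilt).
have -> : [set x | oriented_integral rho (xbar_rec rho n i) x < n%:R^-1] =
    [set x | mass x < i.+1%:R / n%:R].
  apply/funext => x /=; rewrite oriented_integral_mass mi ltrBlDr.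
  by rewrite -[X in X + _]mul1r -mulrDl -natr1 [1 + _]addrC.
apply: (@mass_sup_lt _ (xbar_rec rho n i) (sup (ess_support rho))).
  by rewrite mi ltr_pM2r ?invr_gt0// ltr_nat.
by rewrite mass_sup ltr_pdivrMr// mul1r ltr_nat.
Qed.

Lemma mass_xbar (n i : nat) : (0 < n)%N -> (i <= n)%N ->
  mass (xbar rho n i) = i%:R / n%:R.
Proof.
move=> n0 ilen; rewrite /xbar; case: eqVneq => [->|iN].
  by rewrite mass_sup divff// pnatr_eq0 -lt0n.
by rewrite mass_xbar_rec// ltn_neqAle iN.
Qed.

(** Initially the density of a cell is the mean of [rho] on it.  Let [g] be any
    representative of [rho].  With the signs [s] that realize the absolute
    values of the jumps, summation by parts writes the sum of the jumps as a
    combination of these means.  Each mean can be replaced by the value of [g]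
    at a point of the cell without decreasing the combination; undoing the
    summation by parts bounds it by the variation of [g] along these points, to
    which a zero of [g] on each side of the support is added. *)
Lemma initial_jumps (n : nat) (x : nat -> R -> R) : (0 < n)%N ->
  (forall i, (i <= n)%N -> x i 0 = xbar rho n i) ->
  (forall i, (i < n)%N -> x i 0 < x i.+1 0) ->
  ((\sum_(i < n.+1) `|cell_density n x i.+1 0 - cell_density n x i 0|)%:E <=
   TV rho)%E.
Proof.
move=> n0 x0 xlt.
apply: le_ereal_inf_tmp => _ [g grho <-].
pose a j := cell_density n x j 0.
have a0 : a 0%N = 0 by [].
have an : a n.+1 = 0 by rewrite /a /cell_density ltnn andbF.
pose s i : R := if a i.+1 - a i < 0 then -1 else 1.
pose P y := g y = rho y /\
  (~~ (inf (ess_support rho) <= y <= sup (ess_support rho)) -> rho y = 0).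
have aeP : {ae leb, forall y, P y}.
  by apply: ae_lebW (ae_leb2 grho ae_rho_outside) => y [gy ry]; split => //; exact: gy.
have xinf : x 0%N 0 = inf (ess_support rho).
  by rewrite x0// /xbar; case: eqVneq n0 => // <-.
have xsup : x n 0 = sup (ess_support rho) by rewrite x0// /xbar eqxx.
have pt j : exists y, [/\ j = 0%N -> y < x 0%N 0 /\ g y = 0,
    (0 < j <= n)%N -> x j.-1 0 < y < x j 0 /\
       (s j.-1 - s j) * a j <= (s j.-1 - s j) * g y &
    j = n.+1 -> x n 0 < y /\ g y = 0].
  case: (posnP j) => [->|j0].
    have lt1 : x 0%N 0 - 1 < x 0%N 0 by rewrite ltrBlDr ltrDl.
    have [y /andP[_ y2] [gy ry]] := ae_exists lt1 aeP.
    exists y; split => //; split => //.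
    by rewrite gy ry// negb_and -ltNge -xinf y2.
  have [jn|nj] := leqP j n; last first.
    have lt1 : x n 0 < x n 0 + 1 by rewrite ltrDl.
    have [y /andP[y1 _] [gy ry]] := ae_exists lt1 aeP.
    exists y; split => //; first by move=> jE; rewrite jE in j0.
    split => //; by rewrite gy ry// negb_and -!ltNge -xsup y1 orbT.
  have jn' : (j.-1 < n)%N by rewrite prednK.
  have lt1 : x j.-1 0 < x j 0 by have := xlt _ jn'; rewrite prednK.
  have im : \int[leb]_(y in `[x j.-1 0, x j 0]) rho y = a j * (x j 0 - x j.-1 0).
    rewrite mass_increment ?ltW// /a /cell_density j0 jn/= /local_density prednK//.
    rewrite divfK ?subr_eq0 ?gt_eqF//.
    rewrite !x0//; last exact: ltnW.
    rewrite !mass_xbar//; last exact: ltnW.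
    by rewrite -mulrBl -natrB ?leq_pred// -subn1 subKn// mul1r.
  have ij := integrable_rho_sub (measurable_itv `[x j.-1 0, x j 0]).
  have [y [xy [gy _] sy]] := mean_point (s j.-1 - s j) lt1 ij im aeP.
  exists y; split; first by move=> jE; rewrite jE in j0.
    by rewrite gy.
  by move=> jE; rewrite jE ltnn in jn.
have [y yP] := choice pt.
have y_le j : (j < n.+1)%N -> y j <= y j.+1.
  move=> jn; have [y1 y2 _] := yP j; have [_ z2 z3] := yP j.+1.
  have low : y j < x j 0.
    case: (posnP j) y1 y2 => [-> /(_ erefl)[]//|j0 _].
    by move=> /(_ jn) [/andP[]].
  have upp : x j 0 < y j.+1.
    move: jn; rewrite ltnS leq_eqVlt => /predU1P[jE|jn].
      by move: z3; rewrite jE => /(_ erefl) [].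
    by move: z2; rewrite jn => /(_ erefl) [/andP[]].
  exact: ltW (lt_trans low upp).
have gy0 : g (y 0%N) = 0 by have [/(_ erefl)[]] := yP 0%N.
have gyn : g (y n.+1) = 0 by have [_ _ /(_ erefl)[]] := yP n.+1.
have [y0n tv] := sum_le_total_variation g y_le.
apply: (@le_trans _ _ (total_variation (y 0%N) (y n.+1) g)); last first.
  by apply: ereal_sup_ubound; exists (y 0%N), (y n.+1).
apply: le_trans tv; rewrite lee_fin.
have absE (z : R) : `|z| = (if z < 0 then -1 else 1) * z.
  case: (ltP z 0) => z0; first by rewrite ltr0_norm// mulN1r.
  by rewrite ger0_norm// mul1r.
under eq_bigr do rewrite absE.
rewrite (@sum_by_parts _ n s a a0 an).
apply: (@le_trans _ _ (\sum_(i < n) (s i - s i.+1) * g (y i.+1))).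
  apply: ler_sum => i _; have [_ /= H _] := yP i.+1.
  by have [|_] := H; first exact: ltn_ord.
rewrite -(@sum_by_parts _ n s (g \o y))//=.
apply: ler_sum => i _; apply: le_trans (ler_norm _) _; rewrite normrM.
by rewrite (_ : `|s i| = 1) ?mul1r// /s; case: ifP; rewrite ?normrN normr1.
Qed.

End mass.

(** * Reduction of the four cases to the upwind form *)

Lemma TV_ge0 (R : realType) (f : R -> R) : (0 <= TV f)%E.
Proof.
apply: le_ereal_inf_tmp => _ [g _ <-].
apply: (@le_trans _ _ (total_variation 0 0 g)); first exact: total_variation_ge0.
by apply: ereal_sup_ubound; exists 0, 0.
Qed.

Lemma hyp_V_lipschitz (R : realType) (v : R -> R) : hyp_V v ->
  exists2 Lv : R, 0 <= Lv &
  forall p q : R, 0 <= p -> 0 <= q -> `|v q - v p| <= Lv * `|q - p|.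
Proof.
move=> [[M [_ HM]] _ _]; exists (`|M| + 1) => [|p q p0 q0].
  by rewrite addr_ge0.
have MM : M < `|M| + 1 by rewrite (le_lt_trans (ler_norm _))// ltrDl.
by have := HM _ MM (q, p); apply; split; rewrite /= in_itv/= andbT.
Qed.

(** A field with a zero at the origin and at most linear growth cannot push
    anything across the origin: exponentials [eps * expR ((W * L + 1) * t)] are
    barriers for every [eps]. *)
Lemma stay_nonpositive (R : realType) (y w phi : R -> R) (W L : R) :
  {within `[0, +oo[, continuous y} -> y 0 <= 0 ->
  (forall t : R, 0 < t -> is_derive t 1 y (w t * phi (y t))) ->
  (forall t, 0 < t -> 0 <= w t <= W) ->
  0 <= L -> (forall z : R, `|phi z| <= L * `|z|) ->
  forall t : R, 0 <= t -> y t <= 0.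
Proof.
move=> cy y0 dy wW L0 phiL t t0.
pose K := W * L.
apply/ler_addgt0Pr => e e0; rewrite add0r.
pose eps := e / expR ((K + 1) * t).
have eps0 : 0 < eps by rewrite divr_gt0 ?expR_gt0.
have Db (s : R) : is_derive s 1 (fun s : R => eps * expR ((K + 1) * s))
    (eps * ((K + 1) * expR ((K + 1) * s))).
  exact: (is_derive_eq (is_deriveZ eps (is_derive_expRM (K + 1) s))).
suff H : forall (i : unit) (t : R), 0 <= t -> y t - eps * expR ((K + 1) * t) < 0.
  have := H tt t t0; rewrite /eps divfK ?gt_eqF ?expR_gt0//.
  by rewrite subr_lt0 => /ltW.
apply: first_touch => [_|_|s _ s0 _ ys].
- by apply: within_continuousB => //; exact: is_derive_continuous Db.
- by rewrite mulr0 expR0 mulr1 subr_lt0 (le_lt_trans y0).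
exists (w s * phi (y s) - eps * ((K + 1) * expR ((K + 1) * s))).
  exact: is_deriveB (dy _ s0) (Db s).
have yE : y s = eps * expR ((K + 1) * s) by apply/eqP; rewrite -subr_eq0 ys.
have ypos : 0 < y s by rewrite yE mulr_gt0 ?expR_gt0.
have /andP[w0 w1] := wW s s0.
rewrite mulrCA -yE subr_lt0.
apply: (@le_lt_trans _ _ (K * y s)); last by rewrite ltr_pM2r// ltrDl.
rewrite /K -mulrA; apply: le_trans (ler_norm _) _.
rewrite normrM (ger0_norm w0); apply: ler_pM => //.
by have := phiL (y s); rewrite (gtr0_norm ypos).
Qed.

Lemma upwind_velocity (R : realType) (p a b w : R) :
  (0 < p -> w = a) -> (p < 0 -> w = b) ->
  w * p = a * Num.max p 0 - b * Num.max (- p) 0.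
Proof.
move=> pa pb; case: (ltgtP p 0) => [p0|p0|->].
- by rewrite (pb p0) max_l ?oppr_ge0 1?ltW// mulr0 sub0r mulrN opprK.
- by rewrite (pa p0) [X in _ - b * X]max_r ?oppr_le0 1?ltW// mulr0 subr0.
- by rewrite oppr0 maxxx !mulr0 subrr.
Qed.

Lemma kn_le (R : realType) (rho : R -> R) (n : nat) : (0 < kn rho n)%N ->
  xbar rho n (kn rho n) <= 0.
Proof.
suff : kn rho n = 0%N \/ xbar rho n (kn rho n) <= 0.
  by move=> [->|].
rewrite /kn; elim/big_ind: _ => [|i j|i]; [by left| |by right].
by rewrite /maxn; case: ifP.
Qed.

Lemma kn_lt (R : realType) (rho : R -> R) (n : nat) : (kn rho n < n)%N ->
  0 < xbar rho n (kn rho n).+1.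
Proof.
move=> kn_n; rewrite ltNge; apply/negP => xle.
have := @leq_bigmax_cond _ (fun i : 'I_n.+1 => xbar rho n i <= 0)
  (fun i => i : nat) (Ordinal (kn_n : ((kn rho n).+1 < n.+1)%N)) xle.
by rewrite -/(kn rho n) /= ltnn.
Qed.

Lemma vanish_at_sign_change (R : realType) (phi : R -> R) (L : R) : 0 <= L ->
  (forall a b : R, `|phi b - phi a| <= L * `|b - a|) ->
  (forall z, 0 <= z * phi z) -> phi 0 = 0.
Proof.
move=> L0 lip sg.
have small (e : R) : 0 < e -> exists2 d : R, 0 < d & L * d <= e.
  move=> e0; have L1 : 0 < L + 1 by rewrite ltr_wpDl.
  exists (e / (L + 1)); first by rewrite divr_gt0.
  by rewrite mulrCA ger_pMr// ler_pdivrMr// mul1r lerDl.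
apply/eqP; rewrite eq_le; apply/andP; split.
  apply/ler_addgt0Pr => e /small[d d0 Ld]; rewrite add0r (le_trans _ Ld)//.
  have : phi (- d) <= 0 by have := sg (- d); rewrite nmulr_rge0// oppr_lt0.
  have := lip (- d) 0; rewrite sub0r opprK (gtr0_norm d0) ler_norml => /andP[_].
  by lra.
rewrite -oppr_le0; apply/ler_addgt0Pr => e /small[d d0 Ld].
rewrite add0r (le_trans _ Ld)//.
have : 0 <= phi d by have := sg d; rewrite pmulr_rge0.
have := lip d 0; rewrite sub0r normrN (gtr0_norm d0) ler_norml => /andP[].
by lra.
Qed.

Lemma particle_speed_itv (R : realType) (c : flow_case) (v : R -> R) (n k : nat)
    (x : nat -> R -> R) (i : nat) (t : R) :
  (forall p, 0 <= p -> 0 <= v p <= v 0) ->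
  (forall i, (i < n)%N -> x i t < x i.+1 t) ->
  (0 < i < n)%N ->
  0 <= particle_speed c v n k x i t <= v 0.
Proof.
move=> v01 xlt /andP[i0 iltn].
have loc j : (j < n)%N -> 0 <= v (local_density n x j t) <= v 0.
  by move=> jn; apply: v01; rewrite divr_ge0 ?invr_ge0// subr_ge0 ltW// xlt.
have f := loc i iltn.
have b : 0 <= v (local_density n x i.-1 t) <= v 0.
  by apply: loc; rewrite (leq_ltn_trans (leq_pred i)).
have v00 : 0 <= v 0 <= v 0 by rewrite v01.
by rewrite /particle_speed; case: c; do ?case: ifP.
Qed.

Definition two_sided (c : flow_case) : bool :=
  match c with P1 | P2 => false | P3 | P4 => true end.

Lemma two_sided_vanish (R : realType) (c : flow_case) (phi : R -> R) (L : R) :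
  two_sided c -> 0 <= L ->
  (forall a b : R, `|phi b - phi a| <= L * `|b - a|) ->
  hyp_sign c phi -> phi 0 = 0.
Proof.
case: c => // _ L0 lip sg; first exact: vanish_at_sign_change L0 lip sg.
apply: oppr_inj; rewrite oppr0.
apply: (@vanish_at_sign_change _ (fun z => - phi z) L) => // [a b|z].
  by rewrite -opprD normrN lip.
by rewrite mulrN oppr_ge0.
Qed.

(** [kn] separates the particles on either side of the origin, where [phi]
    vanishes, and no particle crosses it afterwards.  This is what makes the
    index conditions defining the system agree with the sign of [phi]. *)
Lemma two_sided_separation (R : realType) (c : flow_case) (v rho phi : R -> R)
    (n : nat) (x : nat -> R -> R) (L : R) :
  two_sided c -> (forall p, 0 <= p -> 0 <= v p <= v 0) -> 0 <= L ->
  (forall a b : R, `|phi b - phi a| <= L * `|b - a|) ->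
  phi 0 = 0 -> admissible c rho n -> particle_solution c v rho phi n x ->
  forall i t, (i <= n)%N -> 0 <= t ->
    if (i <= kn rho n)%N then x i t <= 0 else 0 <= x i t.
Proof.
move=> c2 v01 L0 lip phi0 adm [x0 xlt cx dx] i t ilen t0.
set k := kn rho n.
have [k2 k3] : (2 <= k)%N /\ (k + 3 <= n)%N by case: c c2 adm {dx} => //= _ [_].
have kn2 : (k.+1 < n)%N by rewrite addn3 in k3; exact: ltnW.
have kn1 : (k < n)%N by exact: ltnW.
have phiL (z : R) : `|phi z| <= L * `|z| by have := lip 0 z; rewrite phi0 !subr0.
have speed j (s : R) : (0 < j < n)%N -> 0 < s ->
    0 <= particle_speed c v n k x j s <= v 0.
  by move=> jn s0; apply: particle_speed_itv => // m mn; apply: xlt => //; exact: ltW.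
have xk : x k t <= 0.
  apply: (@stay_nonpositive _ (x k) (particle_speed c v n k x k) phi (v 0) L
    (cx k (ltnW kn1)) _ _ _ L0 phiL _ t0).
  - by rewrite (x0 k (ltnW kn1)); apply: kn_le; exact: (ltnW k2).
  - by move=> s s0; exact: dx (ltnW kn1) s0.
  - by move=> s s0; apply: speed; rewrite // kn1 andbT ltnW.
have xk1 : 0 <= x k.+1 t.
  rewrite -oppr_le0.
  apply: (@stay_nonpositive _ (fun s => - x k.+1 s) (particle_speed c v n k x k.+1)
    (fun z => - phi (- z)) (v 0) L _ _ _ _ L0 _ _ t0).
  - apply/subspace_continuousP => s sI; apply: cvgN.
    by have /subspace_continuousP := cx _ kn1; exact.
  - by rewrite oppr_le0 (x0 k.+1 kn1); apply/ltW/kn_lt.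
  - move=> s s0; have D := is_deriveN (dx _ _ kn1 s0).
    by apply: (is_derive_eq D); rewrite opprK mulrN.
  - by move=> s s0; apply: speed.
  - by move=> z; rewrite normrN (le_trans (phiL _))// normrN.
have xmono a b : (a <= b <= n)%N -> x a t <= x b t.
  move=> /andP[]; elim: b => [|b IH]; first by rewrite leqn0 => /eqP ->.
  rewrite leq_eqVlt => /predU1P[->//|ab] bn.
  by rewrite (le_trans (IH ab (ltnW bn)))// ltW// xlt.
case: leqP => ik.
  by rewrite (le_trans _ xk)// xmono// ik ltnW.
by rewrite (le_trans xk1)// xmono// ik.
Qed.

(** Where [phi] vanishes the prescribed speed is immaterial; elsewhere the sign
    of [phi] at a particle determines which of the branches defining its speed
    is taken, and this is always the upwind one. *)
Lemma particle_upwind (R : realType) (c : flow_case) (v rho phi : R -> R)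
    (n : nat) (x : nat -> R -> R) (L : R) :
  (forall p, 0 <= p -> 0 <= v p <= v 0) -> 0 <= L ->
  (forall a b : R, `|phi b - phi a| <= L * `|b - a|) ->
  hyp_sign c phi -> admissible c rho n -> particle_solution c v rho phi n x ->
  upwind_solution v phi n x.
Proof.
move=> v01 L0 lip sg adm [x0 xlt cx dx]; split => // i t ilen t0.
have t0' := ltW t0.
apply: (is_derive_eq (dx i t ilen t0)).
have n1 : (0 < n)%N by case: c adm {sg dx} => [||[]|[]].
have cS j : (j < n)%N -> v (cell_density n x j.+1 t) = v (local_density n x j t).
  by move=> jn; rewrite /cell_density/= jn.
have cn : v (cell_density n x n.+1 t) = v 0.
  by rewrite /cell_density ltnn andbF.
have isP : (0 < i)%N -> exists2 j, i = j.+1 & (j < n)%N.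
  by move=> i0; exists i.-1; rewrite prednK.
have fwd : (i < n)%N -> v (local_density n x i t) = v (cell_density n x i.+1 t).
  by move=> iltn; rewrite cS.
have bwd : (0 < i)%N -> v (local_density n x i.-1 t) = v (cell_density n x i t).
  by move=> /isP[j -> jn]; rewrite cS.
have sep : two_sided c -> [/\ phi 0 = 0,
    (0 < (kn rho n))%N, (kn rho n < n)%N &
    if (i <= kn rho n)%N then x i t <= 0 else 0 <= x i t].
  move=> c2; have phi0 := two_sided_vanish c2 L0 lip sg.
  have S := two_sided_separation c2 v01 L0 lip phi0 adm (And4 x0 xlt cx dx) ilen t0'.
  have [k2 k3] : (2 <= kn rho n)%N /\ (kn rho n + 3 <= n)%N.
    by case: c c2 adm {S sg dx} => //= _ [_].
  by split => //; [exact: ltnW|rewrite addn3 in k3; exact: ltnW (ltnW k3)].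
have contra0 : phi 0 = 0 -> phi (x i t) != 0 -> x i t <= 0 -> 0 <= x i t -> False.
  move=> p0 + xl xg; have -> : x i t = 0 by apply/eqP; rewrite eq_le xl xg.
  by rewrite p0 eqxx.
apply: upwind_velocity => p; rewrite /particle_speed;
  case: c sg {adm dx} sep => /= sg sep.
- by case: eqVneq => [->//|iN]; rewrite fwd// ltn_neqAle iN.
- by move: p; rewrite ltNge sg.
- have [p0 k0 kn1 xs] := sep erefl.
  have xg : 0 <= x i t by have := sg (x i t); rewrite pmulr_lge0.
  case: leqP xs => ik xs; first by case: (contra0 p0 _ xs xg); rewrite gt_eqF.
  rewrite gtn_eqF ?(leq_ltn_trans _ ik)//=.
  by case: eqVneq => [->//|iN]; rewrite fwd// ltn_neqAle iN.
- have [p0 k0 kn1 xs] := sep erefl.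
  have xl : x i t <= 0 by have := sg (x i t); rewrite pmulr_lle0.
  case: leqP xs => ik xs; last by case: (contra0 p0 _ xl xs); rewrite gt_eqF.
  by rewrite fwd// (leq_ltn_trans ik).
- by move: p; rewrite ltNge sg.
- by case: (posnP i) => [->//|i0]; rewrite bwd.
- have [p0 k0 kn1 xs] := sep erefl.
  have xl : x i t <= 0 by have := sg (x i t); rewrite nmulr_lge0.
  case: leqP xs => ik xs; last by case: (contra0 p0 _ xl xs); rewrite lt_eqF.
  rewrite [(i == n)]ltn_eqF ?(leq_ltn_trans ik)// orbF.
  by case: (posnP i) => [->//|i0]; rewrite bwd.
- have [p0 k0 kn1 xs] := sep erefl.
  have xg : 0 <= x i t by have := sg (x i t); rewrite nmulr_lle0.
  case: leqP xs => ik xs; first by case: (contra0 p0 _ xs xg); rewrite lt_eqF.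
  by rewrite bwd// (leq_ltn_trans _ ik).
Qed.

(** * The total variation estimate *)

Theorem proposition3p1 (R : realType) (v rho phi dphi : R -> R)
    (hV : hyp_V v) (hI : hyp_I rho) (hP : hyp_P phi dphi)
    (c : flow_case) (hc : hyp_sign c phi)
    (hVstar : c = P4 -> hyp_Vstar v rho) :
  let L' := v 0 * linfty_norm dphi in
  exists alpha beta gamma zeta : R,
    [/\ 0 < alpha, 0 < beta, 0 < gamma, 0 < zeta &
      forall (n : nat) (x : nat -> R -> R),
        admissible c rho n ->
        particle_solution c v rho phi n x ->
        forall t : R, 0 <= t ->
          (TV (discrete_density n x t) <=
            (TV rho + (alpha * t + beta * expR (L' * t))%:E) *
            (expR (gamma * t * (1 + t) + zeta * expR (L' * t)))%:E)%E].
Proof.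
move=> L'.
have [v_lipschitz v_ge0 v_nincr] := hV.
have [Lv Lv0 v_lip] := hyp_V_lipschitz hV.
pose L := linfty_norm dphi.
have phi_lip : forall a b : R, `|phi b - phi a| <= L * `|b - a| := hyp_P_lipschitz hP.
have [H H0 phi_dd] := hyp_P_divided_difference hP.
have L0 : 0 <= L by rewrite fine_ge0// Lnorm_ge0.
have v00 : 0 <= v 0 by rewrite v_ge0.
have L'0 : 0 <= L' by rewrite mulr_ge0.
have [_ [_ TVfin] _ _ _] := hI.
have TVE : TV rho = (fine (TV rho))%:E.
  by rewrite fineK// ge0_fin_numE// TV_ge0.
set V0 := fine (TV rho) in TVE.
have V00 : 0 <= V0 by rewrite fine_ge0// TV_ge0.
pose gamma := L * v 0 + 2 * L * Lv * (V0 + 1) + 1.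
pose zeta := 2 * L * Lv * (V0 + 1) / L' + 1.
have gamma0 : 0 < gamma by rewrite ltr_wpDl// addr_ge0 ?mulr_ge0// addr_ge0.
have zeta0 : 0 < zeta by rewrite ltr_wpDl// divr_ge0// !mulr_ge0// addr_ge0.
have alpha0 : 0 < 4 * H * v 0 + 1 by rewrite ltr_wpDl// !mulr_ge0.
exists (4 * H * v 0 + 1), 1, gamma, zeta; split => // n x adm sol t t0.
have n0 : (0 < n)%N by case: c adm {hc sol hVstar} => [||[]|[]].
have v01 p : 0 <= p -> 0 <= v p <= v 0.
  by move=> p0; rewrite v_ge0// v_nincr.
have up := particle_upwind v01 L0 phi_lip hc adm sol.
have [x0 xlt _ _] := sol.
have jump0 : \sum_(i < n.+1) `|cell_density n x i.+1 0 - cell_density n x i 0| <= V0.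
  rewrite -lee_fin -TVE; apply: initial_jumps => // i ilt; exact: xlt.
have := total_jump_bound up v_ge0 v_nincr phi_lip L0 Lv0 H0 v_lip phi_dd n0 jump0 t0.
rewrite -/L' -/gamma -/zeta => bound.
apply: le_trans (TV_discrete_density _) _ => [i ilt|]; first exact/ltW/xlt.
rewrite TVE -EFinD -EFinM lee_fin (le_trans bound)//.
have E1 : 1 <= expR (L' * t) by rewrite -expR0 ler_expR mulr_ge0.
apply: ler_pM; rewrite ?expR_ge0 ?addr_ge0 ?mulr_ge0 ?(ltW alpha0)//.
  by rewrite mul1r -addrA lerD2l addrC lerD2l.
rewrite ler_expR lerD2r -[leLHS]mulr1 ler_wpM2l ?mulr_ge0 ?(ltW gamma0)//.
by rewrite lerDl.
Qed.
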